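(* For every real-valued $f \in L_{2}[a,c]\oplus L_{2}[c,b]$ the modified Parseval equality $$\gamma_{1}\gamma_{2}\int_{a}^{c} f^{2}(x)\,dx+\delta_{1}\delta_{2}\int_{c}^{b} f^{2}(x)\,dx=\sum_{n=0}^{\infty}\left|\gamma_{1}\gamma_{2}\int_{a}^{c} f(x)\psi_{n}(x)\,dx+\delta_{1}\delta_{2}\int_{c}^{b} f(x)\psi_{n}(x)\,dx\right|^{2}$$ holds, where $\psi_n$ $(n=0,1,2,\dots)$ are the first components of the normalized eigenelements of the Sturm-Liouville transmission problem described in the context.
   Context: Setting. Let $a<c<b$ be real. Let $q$ be real-valued, continuous on $[a,c)$ and on $(c,b]$, with finite limits $q(c\mp 0)$. Let $\alpha_i,\beta_i,\beta_i',\gamma_i,\delta_i$ $(i=1,2)$ be real numbers with $(\alpha_1,\alpha_2)\neq(0,0)$, $\gamma_i\ne 0$, $\delta_i\neq 0$, $\rho:=\beta_1'\beta_2-\beta_1\beta_2'>0$, $\gamma_1\gamma_2>0$ and $\delta_1\delta_2>0$. Write $\tau u:=-u''+q(x)u$, and $$(u)_\beta:=\beta_1u(b)-\beta_2u'(b),\qquad (u)'_\beta:=\beta_1'u(b)-\beta_2'u'(b).$$ Problem. The boundary value transmission problem is: $\tau u=\lambda u$ on $[a,c)\cup(c,b]$, with $\gamma_1u(c-0)=\delta_1u(c+0)$, $\gamma_2u'(c-0)=\delta_2u'(c+0)$, $\alpha_1u(a)+\alpha_2u'(a)=0$, and $(\beta_1'\lambda+\beta_1)u(b)-(\beta_2'\lambda+\beta_2)u'(b)=0$.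 An eigenvalue is a $\lambda\in\mathbb C$ for which there is a nontrivial solution. Hilbert space. $H_1$ is $L_2[a,b]\oplus\mathbb C$ with inner product $$\langle F,G\rangle_1:=|\gamma_1\gamma_2|\int_a^cF_1\overline{G_1}\,dx+|\delta_1\delta_2|\int_c^bF_1\overline{G_1}\,dx+\frac{|\delta_1\delta_2|}{\rho}F_2\overline{G_2},$$ for $F=(F_1,F_2)$, $G=(G_1,G_2)$, and $\|\cdot\|_1$ is the corresponding norm. Solutions and eigenelements. For $\lambda\in\mathbb C$, $\phi(x,\lambda)$ is the function on $[a,c)\cup(c,b]$ which solves $\tau u=\lambda u$ on each of the two intervals and satisfies $\phi(a,\lambda)=\alpha_2$, $\phi'(a,\lambda)=-\alpha_1$, $\phi(c+0,\lambda)=\frac{\gamma_1}{\delta_1}\phi(c-0,\lambda)$, $\phi'(c+0,\lambda)=\frac{\gamma_2}{\delta_2}\phi'(c-0,\lambda)$ (prime denotes $\partial/\partial x$). The problem has infinitely many eigenvalues, all real; $\lambda_n$, $n=0,1,2,\dots$, is an enumeration without repetition of all of them. Put $\Phi_n:=(\phi(\cdot,\lambda_n),(\phi(\cdot,\lambda_n))'_\beta)\in H_1$ and $\psi_n(x):=\phi(x,\lambda_n)/\|\Phi_n\|_1$. *)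

(* Defs.v *)
From HB Require Import structures.
From mathcomp Require Import all_boot all_order all_algebra.
From mathcomp Require Import all_classical all_reals all_analysis.
From mathcomp Require Import complex.

Set Implicit Arguments.
Unset Strict Implicit.
Unset Printing Implicit Defensive.

Import Order.TTheory GRing.Theory Num.Theory.
Import numFieldNormedType.Exports.

Local Open Scope classical_set_scope.
Local Open Scope ring_scope.
Local Open Scope complex_scope.

(* [potential] is total on [R], but only its values on [a, c) and (c, b]
   matter. *)
Record transmission_problem (R : realType) := TransmissionProblem {
  left_end : R;
  interface : R;
  right_end : R;
  potential : R -> R;
  alpha1 : R; alpha2 : R;
  beta1 : R; beta2 : R;
  beta1' : R; beta2' : R;
  gamma1 : R; gamma2 : R;
  delta1 : R; delta2 : R;
  left_end_lt_interface : left_end < interface;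
  interface_lt_right_end : interface < right_end;
  potential_continuous_left :
    {within `[left_end, interface[, continuous potential};
  potential_continuous_right :
    {within `]interface, right_end], continuous potential};
  potential_limit_left :
    exists l : R, potential x @[x --> interface^'-] --> l;
  potential_limit_right :
    exists l : R, potential x @[x --> interface^'+] --> l;
  alpha_neq0 : (alpha1, alpha2) != (0, 0);
  gamma1_neq0 : gamma1 != 0;
  gamma2_neq0 : gamma2 != 0;
  delta1_neq0 : delta1 != 0;
  delta2_neq0 : delta2 != 0;
  rho_gt0 : 0 < beta1' * beta2 - beta1 * beta2';
  gamma12_gt0 : 0 < gamma1 * gamma2;
  delta12_gt0 : 0 < delta1 * delta2
}.

Definition rho (R : realType) (P : transmission_problem R) : R :=
  beta1' P * beta2 P - beta1 P * beta2' P.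

(* Limits, derivatives and integrals of functions [R -> R[i]] are taken
   componentwise, as MathComp-Analysis has no normed-space structure over [R]
   on [R[i]]. *)
Definition ccvg (R : realType) (u : R -> R[i]) (F : set_system R) (l : R[i]) :
    Prop :=
  (complex.Re (u x) @[x --> F] --> complex.Re l) /\
  (complex.Im (u x) @[x --> F] --> complex.Im l).

(* The derivative relative to [D]: at an endpoint of an interval [D] it is the
   one-sided derivative. *)
Definition cderiv_on (R : realType) (D : set R) (u du : R -> R[i]) : Prop :=
  forall x, D x ->
    ccvg (fun y => (u y - u x) / (y - x)%:C) (within D x^') (du x).

Definition cintegral (R : realType) (D : set R) (u : R -> R[i]) : R[i] :=
  (\int[lebesgue_measure]_(x in D) complex.Re (u x))
  +i* (\int[lebesgue_measure]_(x in D) complex.Im (u x)).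

Section Problem.
Context (R : realType) (P : transmission_problem R).
Local Notation a := (left_end P).
Local Notation c := (interface P).
Local Notation b := (right_end P).

(* In what follows [du] is the derivative of [u]. *)
Definition solves_on (lambda : R[i]) (D : set R) (u du : R -> R[i]) : Prop :=
  cderiv_on D u du /\
  exists ddu : R -> R[i], cderiv_on D du ddu /\
    forall x, D x -> - ddu x + (potential P x)%:C * u x = lambda * u x.

Definition solves (lambda : R[i]) (u du : R -> R[i]) : Prop :=
  solves_on lambda `[a, c[ u du /\ solves_on lambda `]c, b] u du.

Definition transmission_condition (u du : R -> R[i]) : Prop :=
  exists ul ur dul dur : R[i],
    [/\ ccvg u c^'- ul, ccvg u c^'+ ur, ccvg du c^'- dul & ccvg du c^'+ dur] /\
    (gamma1 P)%:C * ul = (delta1 P)%:C * ur /\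
    (gamma2 P)%:C * dul = (delta2 P)%:C * dur.

Definition eigenvalue (lambda : R[i]) : Prop :=
  exists u du : R -> R[i],
    [/\ solves lambda u du,
        transmission_condition u du,
        (alpha1 P)%:C * u a + (alpha2 P)%:C * du a = 0,
        ((beta1' P)%:C * lambda + (beta1 P)%:C) * u b
          - ((beta2' P)%:C * lambda + (beta2 P)%:C) * du b = 0 &
        exists2 x, (`[a, c[ `|` `]c, b]) x & u x != 0].

Definition beta_form' (u du : R -> R[i]) : R[i] :=
  (beta1' P)%:C * u b - (beta2' P)%:C * du b.

(* Elements of H_1 are given by representatives: pairs of a function, defined
   almost everywhere on [a, b], and a complex number. *)
Definition inner1 (F G : (R -> R[i]) * R[i]) : R[i] :=
  `|gamma1 P * gamma2 P|%:C * cintegral `[a, c] (fun x => F.1 x * conjc (G.1 x))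
  + `|delta1 P * delta2 P|%:C * cintegral `[c, b] (fun x => F.1 x * conjc (G.1 x))
  + (`|delta1 P * delta2 P| / rho P)%:C * (F.2 * conjc G.2).

Definition norm1 (F : (R -> R[i]) * R[i]) : R :=
  Num.sqrt (complex.Re (inner1 F F)).

Definition fundamental_solution (lambda : R[i]) (phi dphi : R -> R[i]) : Prop :=
  [/\ solves lambda phi dphi,
      phi a = (alpha2 P)%:C,
      dphi a = - (alpha1 P)%:C,
      exists2 l, ccvg phi c^'- l &
        ccvg phi c^'+ ((gamma1 P / delta1 P)%:C * l) &
      exists2 l, ccvg dphi c^'- l &
        ccvg dphi c^'+ ((gamma2 P / delta2 P)%:C * l)].

Definition eigenelement (phi dphi : R -> R[i]) : (R -> R[i]) * R[i] :=
  (phi, beta_form' phi dphi).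

Definition normalized_eigenfunction (phi dphi : R -> R[i]) (x : R) : R[i] :=
  phi x / (norm1 (eigenelement phi dphi))%:C.

Definition enumerates_eigenvalues (lambda : nat -> R[i]) : Prop :=
  injective lambda /\
  forall z : R[i], eigenvalue z <-> exists n, lambda n = z.

End Problem.

(* [f \_ D] extends [f] by [point], which is 0 in [R]. *)
Definition square_integrable_on (R : realType) (D : set R) (f : R -> R) : Prop :=
  f \_ D \in Lfun (@lebesgue_measure R) 2%:E.

(* Main.v *)
Require Import Defs.
From mathcomp Require Import all_boot all_order all_algebra.
From mathcomp Require Import all_classical all_reals all_analysis.
From mathcomp Require Import measurable_realfun.
From mathcomp Require Import complex.
From mathcomp Require Import ring lra.
Import Order.TTheory GRing.Theory Num.Theory.
Import numFieldNormedType.Exports.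
Local Open Scope classical_set_scope.
Local Open Scope ring_scope.
Local Open Scope complex_scope.

Set Implicit Arguments.
Unset Strict Implicit.
Unset Printing Implicit Defensive.

(**
The problem is the eigenvalue problem of a symmetric operator A on the real
space L_2[a,c] x L_2[c,b] x R with the weighted inner product: the second
component carries the eigenparameter in the boundary condition, and the signs
of the weights make the boundary terms of Lagrange's identity cancel. Neither
compactness nor completeness of L_2 is needed. By Gronwall's inequality, for
every real z a solution of (A - z) y = h orthogonal to the eigenvectors at z
satisfies |y| <= C |h|; in particular the eigenvalues do not accumulate. Let K
be the resolvent at a real point nu outside the spectrum. If g is orthogonal
to all eigenvectors with |l_n - nu| <= L then L |K g| <= |g|: the ratios
|K^(k+1) g|^2 / |K^k g|^2 are nondecreasing with a limit r, and if r > 1 / L^2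
then the estimate above at nu + 1 / sqrt r and nu - 1 / sqrt r bounds |K^k g|
by |K^k g - K^(k+2) g / r|, which is o(|K^k g|), a contradiction. Applied to
the remainders of the expansion of U = K H this gives Parseval's equality on
the domain of A, and it extends to the closure, which contains all
(f_1, f_2, 0).
*)

(** * Symmetric operators on semi-inner product spaces *)

(** The domain of the operator consists of classical solutions, so a limit in the norm of [ip] need
    not stay in it. The bound [L |K g| <= |g|] is therefore proved without any limit vector or
    extremal vector: only the numbers [r_k = |K^(k+1) g|^2 / |K^k g|^2] pass to a limit. As [K] is
    symmetric, [|K^k g - K^(k+2) g / r|^2 / |K^k g|^2 = 1 - 2 r_k / r + r_k r_(k+1) / r^2], which
    tends to 0: asymptotically [K^2] multiplies by [r]. The ratios say nothing about the sign of
    [K], so both factors of [1 - K^2 / r] have to be inverted, which is why two points are used;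
    [r > 1 / L^2] places both within [L] of [nu], where [g] is orthogonal to the eigenvectors. The a
    priori estimate itself is a statement about initial values: Gronwall's inequality leaves a
    multiple of the fundamental solution free, and this multiple is controlled by the condition at
    [b] or, at an eigenvalue, by orthogonality. *)

Section SemiInner.
Context (R : realType) (E : lmodType R) (ip : E -> E -> R).
Hypothesis ipC : forall x y, ip x y = ip y x.
Hypothesis ipDZl : forall a x y z, ip (a *: x + y) z = a * ip x z + ip y z.
Hypothesis ip_ge0 : forall x, 0 <= ip x x.

Lemma ip0l z : ip 0 z = 0.
Proof. by have := ipDZl (-1) 0 0 z; rewrite scaler0 addr0 mulN1r addNr. Qed.

Lemma ipDl x y z : ip (x + y) z = ip x z + ip y z.
Proof. by rewrite -[x in LHS]scale1r ipDZl mul1r. Qed.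

Lemma ipZl a x z : ip (a *: x) z = a * ip x z.
Proof. by rewrite -[a *: x]addr0 ipDZl ip0l addr0. Qed.

Lemma ipDr x y z : ip z (x + y) = ip z x + ip z y.
Proof. by rewrite ipC ipDl !(ipC z). Qed.

Lemma ipZr a x z : ip z (a *: x) = a * ip z x.
Proof. by rewrite ipC ipZl ipC. Qed.

Lemma ipNl x z : ip (- x) z = - ip x z.
Proof. by rewrite -scaleN1r ipZl mulN1r. Qed.

Lemma ipNr x z : ip z (- x) = - ip z x.
Proof. by rewrite ipC ipNl ipC. Qed.

Lemma ip_suml (I : Type) (r : seq I) (P : pred I) (F : I -> E) z :
  ip (\sum_(i <- r | P i) F i) z = \sum_(i <- r | P i) ip (F i) z.
Proof.
by elim/big_rec2 : _ => [|i x y _ <-]; rewrite ?ip0l// ipDl.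
Qed.

Definition ipE := (ipDl, ipDr, ipZl, ipZr, ipNl, ipNr).

(** Without definiteness both squares can vanish; then [x - ip x y *: y] has square [-2 (ip x y)^2],
    which is nonnegative only if [ip x y = 0]. *)
Lemma ip_cauchy_schwarz x y : ip x y ^+ 2 <= ip x x * ip y y.
Proof.
have := ip_ge0 (ip y y *: x - ip x y *: y).
have := ip_ge0 (ip x x *: y - ip x y *: x).
have := ip_ge0 (x - ip x y *: y).
rewrite !ipE (ipC y x); move: (ip_ge0 x) (ip_ge0 y).
move: (ip x x) (ip x y) (ip y y) => A B C A0 C0 H1 H2 H3.
have [C_gt0|C_le0] := ltP 0 C.
  rewrite -subr_ge0 -(pmulr_rge0 _ C_gt0); lra.
have C00 : C = 0 by lra.
have [A_gt0|A_le0] := ltP 0 A.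
  rewrite -subr_ge0 -(pmulr_rge0 _ A_gt0); lra.
have A00 : A = 0 by lra.
subst; lra.
Qed.

Lemma ip_add_le x y : ip (x + y) (x + y) <= 2 * (ip x x + ip y y).
Proof. by have := ip_ge0 (x - y); rewrite !ipE; lra. Qed.

(** * Bessel's identity and remainders of orthonormal expansions *)

Section Orthonormal.
Context (e : nat -> E).
Hypothesis e_orth : forall m n, ip (e m) (e n) = (m == n)%:R.

Definition remainder N x := x - \sum_(i < N) ip x (e i) *: e i.

Lemma remainder_orth N x n : (n < N)%N -> ip (remainder N x) (e n) = 0.
Proof.
move=> nN; rewrite /remainder ipDl ipNl ip_suml (bigD1 (Ordinal nN))//=.
rewrite ipZl e_orth eqxx mulr1 big1 ?addr0 ?subrr// => i iN.
by rewrite ipZl e_orth -[(_ == _)]/(i == Ordinal nN) (negbTE iN) mulr0.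
Qed.

Lemma ip_remainder N x : ip (remainder N x) (remainder N x) =
  ip x x - \sum_(i < N) ip x (e i) ^+ 2.
Proof.
have -> : ip (remainder N x) (remainder N x) = ip (remainder N x) x.
  rewrite {2}/remainder ipDr ipNr [X in _ - X](_ : _ = 0) ?subr0//.
  rewrite ipC ip_suml big1// => i _.
  by rewrite ipZl (ipC (e i)) remainder_orth// mulr0.
rewrite /remainder ipDl ipNl ip_suml; congr (_ - _).
by apply: eq_bigr => i _; rewrite ipZl (ipC (e i)) expr2.
Qed.

Lemma ip_remainder_le N x : ip (remainder N x) (remainder N x) <= ip x x.
Proof.
by rewrite ip_remainder lerBlDr lerDl sumr_ge0// => i _; exact: sqr_ge0.
Qed.

Lemma remainderB N x y : remainder N (x - y) = remainder N x - remainder N y.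
Proof.
rewrite /remainder; under eq_bigr => i _ do rewrite ipDl ipNl scalerBl.
by rewrite sumrB opprB [X in _ + X]addrC addrACA [in RHS]opprB [X in _ + X]addrC.
Qed.

(** The error of a partial sum is the square of the remainder of [F], and taking remainders does not
    increase norms, so an approximation [U] of [F] suffices. *)
Lemma remainder_cvg_closure F :
  (forall eps, 0 < eps -> exists U, ip (F - U) (F - U) < eps /\
     (exists N0, forall N, (N0 <= N)%N ->
         ip (remainder N U) (remainder N U) < eps)) ->
  series (fun n => ip F (e n) ^+ 2) @ \oo --> ip F F.
Proof.
move=> H; apply/cvgrPdist_lt => eps eps0.
(* Two squares below [eps / 4], with the factor 2 of [ip_add_le], stay below [eps]. *)
have [|U [FU [N0 HN0]]] := H (eps / 4); first by rewrite divr_gt0.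
exists N0 => // N /= N0N.
rewrite /series/= big_mkord -ip_remainder ger0_norm//.
have -> : remainder N F = remainder N (F - U) + remainder N U.
  by rewrite remainderB subrK.
have := ip_add_le (remainder N (F - U)) (remainder N U).
have := ip_remainder_le N (F - U).
have := HN0 _ N0N.
by lra.
Qed.

End Orthonormal.

(** * Parseval's equality for a symmetric operator with an a priori estimate *)

Section Spectral.
(** [T u h] stands for [A u = h]; it is a relation because solutions are determined only up to null
    vectors. [S] holds right-hand sides for which the equation at [nu0] is solvable and contains all
    solutions, so that the resolvent can be iterated. *)
Context (T : E -> E -> Prop) (S : E -> Prop).
Hypothesis T_lin : forall a u h w g, T u h -> T w g -> T (a *: u + w) (a *: h + g).
Hypothesis T_sym : forall u h w g, T u h -> T w g -> ip h w = ip u g.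
Hypothesis TS : forall u h, T u h -> S u /\ S h.
Context (nu0 : R).
Hypothesis T_solve : forall h, S h -> exists u, T u (h + nu0 *: u).
Context (e : nat -> E) (l : nat -> R).
Hypothesis Te : forall n, T (e n) (l n *: e n).
Hypothesis e_orth : forall m n, ip (e m) (e n) = (m == n)%:R.
Hypothesis l_inj : injective l.
Hypothesis l_nu0 : forall n, l n != nu0.
Hypothesis T_apriori : forall z : R, exists2 C : R, 0 < C & forall y h,
  T y (h + z *: y) -> (forall n, l n = z -> ip y (e n) = 0) ->
  ip y y <= C * ip h h.

(** * Powers of the resolvent on a vector orthogonal to the nearby eigenvectors *)

Section Power.
Context (L : R) (g : nat -> E).
Hypothesis L0 : 0 < L.
Hypothesis Tg : forall k, T (g k.+1) (g k + nu0 *: g k.+1).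
Hypothesis g_orth : forall n, `|l n - nu0| <= L -> ip (g 0%N) (e n) = 0.

Let s k := ip (g k) (g k).

Lemma power_sym i j : ip (g i) (g j.+1) = ip (g i.+1) (g j).
Proof. by have := T_sym (Tg i) (Tg j); rewrite !ipE; lra. Qed.

Lemma power_ip k : ip (g k) (g k.+2) = s k.+1.
Proof. exact: power_sym. Qed.

(** Pairing with [e n] turns the resolvent into division by [l n - nu0], so a coefficient that
    vanishes for [g 0] vanishes for every [g k]. *)
Lemma power_orth k n : `|l n - nu0| <= L -> ip (g k) (e n) = 0.
Proof.
move=> lnL; elim: k => [|k IH]; first exact: g_orth.
have := T_sym (Tg k) (Te n); rewrite !ipE IH add0r => /eqP.
rewrite -subr_eq0 -mulrBl mulf_eq0 subr_eq0 eq_sym (negbTE (l_nu0 n))/=.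
by move/eqP.
Qed.

(** This is what makes the ratios [s k.+1 / s k] nondecreasing. *)
Lemma power_log_convex k : s k.+1 ^+ 2 <= s k * s k.+2.
Proof. by rewrite -power_ip; exact: ip_cauchy_schwarz. Qed.

Lemma power_bound : exists2 C : R, 0 < C & forall k, s k.+1 <= C * s k.
Proof.
have [C C0 HC] := T_apriori nu0; exists C => // k; apply: (HC _ (g k)) => //.
by move=> n ln; have := l_nu0 n; rewrite ln eqxx.
Qed.

(* [1 - (K / mu) ^ 2] is bounded below on the [g k], where [K] is the resolvent
   at [nu0], since neither of [nu0 + 1 / mu] and [nu0 - 1 / mu] is an eigenvalue
   with an eigenvector not orthogonal to [g k]. *)
Lemma power_gap mu : 0 < mu -> 1 < mu * L ->
  exists2 C : R, 0 < C & forall k,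
    s k.+1 <= C * (s k - 2 * s k.+1 / mu ^+ 2 + s k.+2 / (mu ^+ 2) ^+ 2).
Proof.
move=> mu0 muL.
have muV : mu^-1 < L by rewrite -ltr_pdivrMl ?mulr1 in muL.
have muV0 : 0 < mu^-1 by rewrite invr_gt0.
have [C1 C10 HC1] := T_apriori (nu0 + mu^-1).
have [C2 C20 HC2] := T_apriori (nu0 - mu^-1).
exists (C2 * (2 * (1 + (mu^-1) ^+ 2 * C1))).
  by rewrite mulr_gt0// mulr_gt0// addr_gt0// mulr_gt0// exprn_gt0.
move=> k; set m := mu^-1.
(* With [K] the resolvent at [nu0]: [w = (1 + m K) g_k], [y = K w] and [h = (1 - m K) w], so
   [(A - nu0 - m) y = h] and [(A - nu0 + m) g_(k+1) = w]. The two estimates are chained through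
   [w = h + m y]. *)
pose h := g k - m ^+ 2 *: g k.+2.
pose y := g k.+1 + m *: g k.+2.
pose w := g k + m *: g k.+1.
have hE : s k - 2 * s k.+1 / mu ^+ 2 + s k.+2 / (mu ^+ 2) ^+ 2 = ip h h.
  rewrite /h !ipE (ipC (g k.+2) (g k)) power_ip -/(s k) -/(s k.+2).
  by rewrite /m -!exprVn; ring.
rewrite hE.
have yb : ip y y <= C1 * ip h h.
  apply: HC1.
    have := T_lin m (Tg k.+1) (Tg k); rewrite [X in T X _]addrC.
    rewrite -/y (_ : _ + (g k + _) = h + (nu0 + m) *: y)//.
    rewrite /h /y !scalerDr !scalerDl !scalerA -expr2.
    rewrite [RHS](AC (2*(2*2)) ((2*6)*((4*5)*(1*3)))).
    by rewrite /= addNr add0r (mulrC nu0).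
  move=> n ln; have lnL : `|l n - nu0| <= L.
    by rewrite ln addrAC subrr add0r gtr0_norm// ltW.
  by rewrite ipDl ipZl !power_orth// mulr0 addr0.
have wb : ip w w <= 2 * (1 + m ^+ 2 * C1) * ip h h.
  have -> : w = h + m *: y.
    rewrite /w /h /y scalerDr scalerA -expr2.
    by rewrite [_ + m ^+ 2 *: _]addrC addrA subrK.
  have := ip_add_le h (m *: y); rewrite (ipZl _ y) ipZr.
  suff : m ^+ 2 * ip y y <= m ^+ 2 * C1 * ip h h by rewrite expr2; lra.
  by rewrite -mulrA ler_pM2l// exprn_gt0.
apply: (@le_trans _ _ (C2 * ip w w)); last by rewrite -mulrA ler_pM2l.
apply: HC2.
  rewrite (_ : w + _ = g k + nu0 *: g k.+1)//.
  by rewrite /w scalerBl -addrA; congr (_ + _); rewrite addrC subrK.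
move=> n ln; apply: power_orth.
by rewrite ln addrAC subrr add0r normrN gtr0_norm// ltW.
Qed.

Lemma power_contract : L ^+ 2 * s 1%N <= s 0%N.
Proof.
rewrite leNgt; apply/negP => s01.
have s_ge0 k : 0 <= s k by exact: ip_ge0.
have L20 : 0 < L ^+ 2 by rewrite exprn_gt0.
(* By log-convexity a zero at either end of three consecutive terms forces a zero in the middle,
   while [s 1] is positive by assumption. *)
have s_gt0 k : 0 < s k /\ 0 < s k.+1.
  elim: k => [|k [IH1 IH2]].
    have s1 : 0 < s 1%N by rewrite -(pmulr_rgt0 _ L20) (le_lt_trans (s_ge0 0%N)).
    split=> //; rewrite lt_neqAle s_ge0 andbT; apply/eqP => s00.
    have := power_log_convex 0; rewrite -s00 mul0r.
    by rewrite leNgt exprn_gt0.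
  split => //; rewrite lt_neqAle s_ge0 andbT; apply/eqP => s00.
  have := power_log_convex k; rewrite -s00 mulr0.
  by rewrite leNgt exprn_gt0.
have {}s_gt0 k : 0 < s k by have [] := s_gt0 k.
pose r k := s k.+1 / s k.
have r_gt0 k : 0 < r k by rewrite divr_gt0.
have r_nd : nondecreasing_seq r.
  apply/nondecreasing_seqP => k; rewrite /r ler_pdivrMr//.
  rewrite mulrAC ler_pdivlMr// -expr2 mulrC.
  exact: power_log_convex.
(* The resolvent is bounded because [nu0] is not an eigenvalue; hence the ratios have a finite
   limit. *)
have [B B0 HB] := power_bound.
have r_ub : has_ubound (range r).
  by exists B => _ [k _ <-]; rewrite /r ler_pdivrMr.
have r_cvg := nondecreasing_cvgn r_nd r_ub.
set r0 := sup _ in r_cvg.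
have r_le k : r k <= r0.
  have <- : limn r = r0 by apply/cvg_lim.
  exact: nondecreasing_cvgn_le r_nd (cvgP _ r_cvg) k.
have r00 : 0 < r0 by exact: lt_le_trans (r_gt0 0%N) (r_le 0%N).
have mu0 : 0 < Num.sqrt r0 by rewrite sqrtr_gt0.
(* Thus [1 / sqrt r0 < L], as [power_gap] requires. *)
have r0L : 1 < r0 * L ^+ 2.
  apply: (@lt_le_trans _ _ (r 0%N * L ^+ 2)); last by rewrite ler_pM2r.
  by rewrite /r mulrAC ltr_pdivlMr// mul1r mulrC.
have [|C C0 HC] := power_gap mu0.
  rewrite -(@ltr_pXn2r _ 2)// ?nnegrE ?mulr_ge0// ?ltW//.
  by rewrite expr1n exprMn sqr_sqrtr// ltW.
rewrite sqr_sqrtr ?(ltW r00)// in HC.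
have rC k : r k <= C * (1 - 2 * r k / r0 + r k * r k.+1 / r0 ^+ 2).
  have -> : r k * r k.+1 = s k.+2 / s k.
    by rewrite /r; field; rewrite !gt_eqF.
  rewrite {1}/r ler_pdivrMr//; apply: le_trans (HC k) _.
  by rewrite le_eqVlt; apply/orP; left; apply/eqP; rewrite /r; field; rewrite !gt_eqF.
(* In the limit the bracket is [1 - 2 + 1 = 0], which contradicts [r0 > 0]. *)
have : r0 <= C * (1 - 2 * r0 / r0 + r0 * r0 / r0 ^+ 2).
  have cr1 : r k.+1 @[k --> \oo] --> r0 by rewrite (cvg_shiftS r).
  have cr2 : 2 * r k / r0 @[k --> \oo] --> 2 * r0 / r0.
    by apply: cvgMr_tmp; exact: cvgMl_tmp.
  have cr3 : r k * r k.+1 / r0 ^+ 2 @[k --> \oo] --> r0 * r0 / r0 ^+ 2.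
    by apply: cvgMr_tmp; exact: cvgM.
  have cr4 : C * (1 - 2 * r k / r0 + r k * r k.+1 / r0 ^+ 2) @[k --> \oo] -->
      C * (1 - 2 * r0 / r0 + r0 * r0 / r0 ^+ 2).
    by apply: cvgMl_tmp; apply: cvgD cr3; apply: cvgB cr2; exact: cvg_cst.
  by apply: (ler_cvg_to r_cvg cr4); apply: nearW => k; exact: rC.
rewrite expr2 divff ?mulf_neq0 ?gt_eqF// -mulrA divff ?gt_eqF// mulr1.
by rewrite leNgt; move/negP; apply; lra.
Qed.

End Power.

Lemma resolvent_contract L g u : 0 < L -> T u (g + nu0 *: u) ->
  (forall n, `|l n - nu0| <= L -> ip g (e n) = 0) ->
  L ^+ 2 * ip u u <= ip g g.
Proof.
move=> L0 Tu g_orth.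
have /choice[K HK] : forall h, exists u, S h -> T u (h + nu0 *: u).
  move=> h; have [Sh|nSh] := pselect (S h); last by exists 0.
  by have [w Tw] := T_solve Sh; exists w.
(* The sequence starts with the given [u], since [K g] could be another solution; only the later
   terms come from choice. *)
pose G k := if k is k'.+1 then iter k' K u else g.
have SG k : S (iter k K u).
  elim: k => [|k IH]; first by have [] := TS Tu.
  by have [] := TS (HK _ IH).
apply: (@power_contract L G) => //.
by case=> [|k]//=; exact: HK.
Qed.

(** [e n] is a unit vector with [(A - z) e_n = (l_n - z) e_n], so the a priori estimate at [z] gives
    [1 <= C (l_n - z)^2]. *)
Lemma eigen_isolated z : exists2 d, 0 < d & forall n, l n != z -> d <= `|l n - z|.
Proof.
have [C C0 HC] := T_apriori z; exists (Num.sqrt C^-1) => [|n lnz].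
  by rewrite sqrtr_gt0 invr_gt0.
have := HC (e n) ((l n - z) *: e n).
rewrite -scalerDl subrK => /(_ (Te n)).
rewrite !ipE e_orth eqxx !mulr1 -expr2 => H.
rewrite -sqrtr_sqr ler_sqrt ?sqr_ge0//.
rewrite -ler_pdivrMl// mulr1 in H; apply: H => m lm.
by rewrite e_orth; case: eqP => // nm; rewrite nm lm eqxx in lnz.
Qed.

(** Infinitely many of them would cluster in a compact interval, against [eigen_isolated] and the
    injectivity of [l]. *)
Lemma finitely_many_eigenvalues L : exists N, forall n, `|l n - nu0| <= L -> (n < N)%N.
Proof.
apply: contrapT => /forallNP H.
have {}H N : exists n, (N <= n)%N /\ `|l n - nu0| <= L.
  have /existsNP[n /not_implyP[nL /negP]] := H N.
  by rewrite -leqNgt => Nn; exists n.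
have /choice[k Hk] := H.
pose F : set_system R := (l \o k) @ \oo.
have FF : ProperFilter F by exact: fmap_proper_filter.
have : F [set` `[nu0 - L, nu0 + L]].
  exists 0%N => // n _; rewrite /= in_itv/=.
  by have [_] := Hk n; rewrite ler_norml; lra.
move=> /(segment_compact FF)[z [_ zcl]].
have [d d0 Hd] := eigen_isolated z.
have ev M : exists2 n, (M <= n)%N & `|l n - z| < d.
  have FM : F [set l n | n in [set n | (M <= n)%N]].
    exists M => // n /= Mn; exists (k n) => //=.
    by rewrite (leq_trans Mn)//; have [] := Hk n.
  have [_ [[n Mn <-] zn]] := zcl _ _ FM (nbhsx_ballx z d d0).
  by exists n => //; rewrite distrC.
have lz n : `|l n - z| < d -> l n = z.
  by move=> H1; apply/eqP/negPn/negP => /Hd; rewrite leNgt H1.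
have [n1 _ /lz n1z] := ev 0%N.
have [n2 n12 /lz n2z] := ev n1.+1.
by move: n12; rewrite (l_inj (etrans n1z (esym n2z))) ltnn.
Qed.

(** Expansion commutes with the resolvent: symmetry gives
    [ip H (e i) = (l i - nu0) * ip U (e i)]. *)
Lemma T_remainder U H N : T U (H + nu0 *: U) ->
  T (remainder e N U) (remainder e N H + nu0 *: remainder e N U).
Proof.
move=> TU; have He i : ip H (e i) = (l i - nu0) * ip U (e i).
  by have := T_sym TU (Te i); rewrite !ipE; lra.
rewrite /remainder; elim: N => [|N IH]; first by rewrite !big_ord0 !subr0.
rewrite !big_ord_recr/= !opprD !addrA.
have := T_lin (- ip U (e N)) (Te N) IH.
set A := U - _; set B := H - _; rewrite scaleNr [- _ + A]addrC.
move: A B => A B; congr (T _ _); rewrite He scalerBr addrACA -opprD !scalerA -scalerDl addrC.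
by rewrite -scaleNr; congr (_ *: _ + _); ring.
Qed.

(** The remainder of [U] is the resolvent of the remainder of [G], which for large [N] is orthogonal
    to every eigenvector with eigenvalue within [L] of [nu0]; its square is then at most
    [ip G G / L^2]. *)
Lemma parseval_dom U H eps : T U H -> 0 < eps -> exists N0, forall N, (N0 <= N)%N ->
  ip (remainder e N U) (remainder e N U) < eps.
Proof.
move=> TU eps0; pose G := H - nu0 *: U.
have {}TU : T U (G + nu0 *: U) by rewrite subrK.
(* The [+ 1] makes [L] positive even for a null [G] and the final inequality strict. *)
pose L := Num.sqrt ((ip G G + 1) / eps).
have G1 : 0 < ip G G + 1 by rewrite ltr_wpDl.
have L0 : 0 < L by rewrite sqrtr_gt0 divr_gt0.
have [N0 HN0] := finitely_many_eigenvalues L.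
exists N0 => N N0N.
have : L ^+ 2 * ip (remainder e N U) (remainder e N U) <= ip G G.
  apply: le_trans (ip_remainder_le e_orth N G).
  apply: resolvent_contract => //; first exact: T_remainder.
  by move=> n /HN0 nN; apply: remainder_orth => //; exact: leq_trans N0N.
rewrite [L ^+ 2]sqr_sqrtr; last by rewrite divr_ge0 ?ltW.
rewrite mulrAC ler_pdivrMr//.
set X := ip (remainder _ _ _) _ => HX; rewrite ltNge; apply/negP => epsX.
have : (ip G G + 1) * eps <= (ip G G + 1) * X by rewrite ler_pM2l.
have := ip_ge0 G; nra.
Qed.

Lemma parseval_closure F :
  (forall eps, 0 < eps -> exists U H, T U H /\ ip (F - U) (F - U) < eps) ->
  series (fun n => ip F (e n) ^+ 2) @ \oo --> ip F F.
Proof.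
move=> dF; apply: remainder_cvg_closure => // eps eps0.
have [U [H [TU FU]]] := dF _ eps0; exists U; split => //.
exact: parseval_dom TU eps0.
Qed.

End Spectral.
End SemiInner.

(** * Linear second order equations on an interval *)

Section WithinContinuous.
Context (R : realType) (A : set R).
Implicit Types f g : R -> R.

Lemma within_continuousD f g : {within A, continuous f} ->
  {within A, continuous g} -> {within A, continuous (fun x => f x + g x)}.
Proof. by move=> cf cg x; apply: cvgD; [exact: cf|exact: cg]. Qed.

Lemma within_continuousB f g : {within A, continuous f} ->
  {within A, continuous g} -> {within A, continuous (fun x => f x - g x)}.
Proof. by move=> cf cg x; apply: cvgB; [exact: cf|exact: cg]. Qed.

Lemma within_continuousM f g : {within A, continuous f} ->
  {within A, continuous g} -> {within A, continuous (fun x => f x * g x)}.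
Proof. by move=> cf cg x; apply: cvgM; [exact: cf|exact: cg]. Qed.

Lemma within_continuous_cst (k : R) : {within A, continuous (fun=> k)}.
Proof. by move=> x; exact: cvg_cst. Qed.

Lemma within_continuousT f : continuous f -> {within A, continuous f}.
Proof. exact: continuous_subspaceT. Qed.

End WithinContinuous.

(** * Primitives of continuous functions *)

Section Integrals.
Context (R : realType).
Notation mu := (@lebesgue_measure R).
Implicit Types (a b : R) (f F : R -> R).

Lemma within_continuous_integrable a b f : {within `[a, b], continuous f} ->
  mu.-integrable `[a, b] (EFin \o f).
Proof. by move=> cf; apply: continuous_compact_integrable => //; exact: segment_compact. Qed.

Lemma within_continuous_oo a b f x : {within `[a, b], continuous f} ->
  x \in `]a, b[ -> {for x, continuous f}.
Proof.
move=> cf /[dup]; rewrite {1}in_itv/= => /andP[ax xb] xab.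
by have [+ _ _] := (continuous_within_itvP f (lt_trans ax xb)).1 cf; apply.
Qed.

Lemma within_continuous_derivable a b F f : a < b ->
  {within `[a, b], continuous F} ->
  {in `]a, b[, forall x : R, is_derive x (1 : R) F (f x)} ->
  derivable_oo_LRcontinuous F a b.
Proof.
move=> ab cF dF; have [_ Fa Fb] := (continuous_within_itvP F ab).1 cF.
by split => // x /dF[].
Qed.

Lemma Rintegral_FTC2 a b F f : a < b ->
  {within `[a, b], continuous F} -> {within `[a, b], continuous f} ->
  {in `]a, b[, forall x : R, is_derive x (1 : R) F (f x)} ->
  \int[mu]_(x in `[a, b]) f x = F b - F a.
Proof.
move=> ab cF cf dF; rewrite /Rintegral (continuous_FTC2 (F := F) ab cf)//.
  exact: within_continuous_derivable cF dF.
by move=> x /dF; rewrite derive1E => /@derive_val.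
Qed.

Definition primitive a f x := \int[mu]_(t in `[a, x]) f t.

Lemma primitive_continuous a b f : a <= b -> {within `[a, b], continuous f} ->
  {within `[a, b], continuous (primitive a f)}.
Proof.
by move=> ab cf; apply: parameterized_integral_continuous => //; exact: within_continuous_integrable.
Qed.

Lemma primitive_derive a b f : {within `[a, b], continuous f} ->
  {in `]a, b[, forall x : R, is_derive x (1 : R) (primitive a f) (f x)}.
Proof.
move=> cf x xab; have cfx := within_continuous_oo cf xab.
move: xab; rewrite in_itv/= => /andP[ax xb].
have [d <-] := continuous_FTC1_closed xb (within_continuous_integrable cf) ax cfx.
by rewrite derive1E; exact: DeriveDef.
Qed.

Lemma primitive_id a f : primitive a f a = 0.
Proof. by rewrite /primitive set_itv1 Rintegral_set1. Qed.

Lemma derive_le0_le a b F f : a <= b -> {within `[a, b], continuous F} ->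
  {in `]a, b[, forall x : R, is_derive x (1 : R) F (f x)} ->
  {in `]a, b[, forall x, f x <= 0} -> {in `[a, b], forall x, F x <= F a}.
Proof.
move=> ab cF dF f0 x /[dup] xab; rewrite in_itv/= => /andP[ax xb].
apply: (@ler0_derive1_le_cc _ F a b) => //.
- by move=> y /dF[].
- by move=> y yab; have [_] := dF _ yab; rewrite derive1E => ->; exact: f0.
- by rewrite in_itv/= lexx.
Qed.

Lemma within_continuous_bounded a b f : {within `[a, b], continuous f} ->
  exists2 M, 0 < M & {in `[a, b], forall x, `|f x| <= M}.
Proof.
move=> cf; have := continuous_compact cf (@segment_compact _ a b).
move/compact_bounded => -[M [_ HM]]; exists (`|M| + 1); first by rewrite ltr_wpDl.
move=> x xab; apply: HM; last by exists x.
by rewrite (le_lt_trans (ler_norm M))// ltrDl.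
Qed.

End Integrals.

(** * Lagrange's identity and Gronwall's inequality *)

Section Ode.
Context (R : realType).
Notation mu := (@lebesgue_measure R).
Implicit Types (a b : R) (q u v h w z g : R -> R).

(** The equation [- u'' + q u = h] as a first-order system. Carrying [v = u'] as a continuous
    function gives the derivative a value at the end points, although derivatives are taken only
    inside. *)
Definition ode a b q u v h : Prop :=
  [/\ {within `[a, b], continuous u}, {within `[a, b], continuous v},
      {within `[a, b], continuous h} &
      {in `]a, b[, forall x : R, is_derive x (1 : R) u (v x) /\
                             is_derive x (1 : R) v (q x * u x - h x)}].

Lemma ode_lin a b q k u v h w z g : ode a b q u v h -> ode a b q w z g ->
  ode a b q (fun x => k * u x + w x) (fun x => k * v x + z x)
    (fun x => k * h x + g x).
Proof.
have cD f1 f2 : {within `[a, b], continuous f1} -> {within `[a, b], continuous f2} ->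
    {within `[a, b], continuous (fun x => k * f1 x + f2 x)}.
  by move=> ? ?; apply: within_continuousD => //; apply: within_continuousM => //;
    exact: within_continuous_cst.
move=> [cu cv ch d1] [cw cz cg d2]; split; [exact: cD..|].
move=> x xab; have [? ?] := d1 _ xab; have [? ?] := d2 _ xab; split.
  by apply: is_derive_eq; rewrite [in LHS]/GRing.scale/=.
apply: is_derive_eq; rewrite [in LHS]/GRing.scale/=; ring.
Qed.

Lemma ode_shift a b q k u v h : ode a b q u v h ->
  ode a b (fun x => q x - k) u v (fun x => h x - k * u x).
Proof.
move=> [cu cv ch d]; split => //.
  by apply: within_continuousB => //; apply: within_continuousM => //;
    exact: within_continuous_cst.
move=> x /d[du dv]; split => //; apply: is_derive_eq; ring.
Qed.

Lemma ode_eq a b q u v h u' v' h' : a < b -> {in `[a, b], u =1 u'} ->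
  {in `[a, b], v =1 v'} -> {in `[a, b], h =1 h'} ->
  ode a b q u v h -> ode a b q u' v' h'.
Proof.
move=> ab uu' vv' hh'.
have eqc f g : {in `[a, b], f =1 g} -> {within `[a, b], continuous f} ->
    {within `[a, b], continuous g}.
  move=> fg; apply: subspace_eq_continuous => x; rewrite inE/= => xab.
  exact: fg.
have eqd f g d x : {in `[a, b], f =1 g} -> x \in `]a, b[ -> is_derive x 1 f d ->
    is_derive x 1 g d.
  move=> fg xab; apply: near_eq_is_derive.
  have := near_in_itvoo xab; apply: filterS => y yab.
  by rewrite fg//; exact: subset_itv_oo_cc.
move=> [cu cv ch d]; split; [exact: eqc cu|exact: eqc cv|exact: eqc ch|].
move=> x xab; have [d1 d2] := d _ xab.
have xab' : x \in `[a, b] by exact: subset_itv_oo_cc.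
rewrite -uu'// -vv'// -hh'//; split; first exact: eqd d1.
exact: eqd d2.
Qed.

(** The difference of the integrands is the derivative of the Wronskian [u z - v w], as the
    potential cancels. *)
Lemma ode_lagrange a b q u v h w z g : a < b ->
  ode a b q u v h -> ode a b q w z g ->
  \int[mu]_(x in `[a, b]) (h x * w x) - \int[mu]_(x in `[a, b]) (u x * g x) =
  (u b * z b - v b * w b) - (u a * z a - v a * w a).
Proof.
move=> ab [cu cv ch d1] [cw cz cg d2].
have c1 := within_continuousM ch cw; have c2 := within_continuousM cu cg.
rewrite -RintegralB//; [|exact: within_continuous_integrable..].
rewrite (@Rintegral_FTC2 _ a b (fun x => u x * z x - v x * w x))//.
- by apply: within_continuousB; exact: within_continuousM.
- exact: within_continuousB.
move=> x xab; have [? ?] := d1 _ xab; have [? ?] := d2 _ xab.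
by apply: is_derive_eq; rewrite [in LHS]/GRing.scale/=; ring.
Qed.

(** For [E = u^2 + v^2] one has [E' <= L E + h^2], so [exp (- L (x - a)) E] minus the primitive of
    [h^2] does not increase. *)
Lemma ode_gronwall a b q : a < b -> {within `[a, b], continuous q} ->
  exists2 C : R, 0 < C & forall u v h, ode a b q u v h ->
    {in `[a, b], forall x, u x ^+ 2 + v x ^+ 2 <=
      C * (u a ^+ 2 + v a ^+ 2 + \int[mu]_(t in `[a, b]) (h t * h t))}.
Proof.
move=> ab cq; have [M M0 qM] := within_continuous_bounded cq.
(* [2 u v <= E], [2 q u v <= M E] and [- 2 v h <= v^2 + h^2] add up to at most [(M + 2) E + h^2]. *)
pose L := M + 2; exists (expR (L * (b - a))); first exact: expR_gt0.
move=> u v h [cu cv ch d].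
have chh := within_continuousM ch ch.
pose E x := u x ^+ 2 + v x ^+ 2.
pose G x := expR (- (L * (x - a))) * E x - primitive a (fun t => h t * h t) x.
pose dG x := expR (- (L * (x - a))) * (2 * u x * v x + 2 * v x * (q x * u x - h x) - L * E x) - h x * h x.
have L0 : 0 < L by rewrite addr_gt0.
have GG : {in `[a, b], forall x, G x <= G a}.
  apply: (@derive_le0_le _ a b G dG (ltW ab)).
  - apply: within_continuousB; last exact: primitive_continuous (ltW ab) chh.
    apply: within_continuousM; last first.
      by apply: within_continuousD; exact: within_continuousM.
    apply: within_continuousT => x.
    apply: (@continuous_comp _ _ _ (fun y => - (L * (y - a))) expR);
      last exact: continuous_expR.
    apply: cvgN; apply: cvgMl_tmp; apply: cvgB; [exact: cvg_id|exact: cvg_cst].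
  - move=> x xab; have [? ?] := d _ xab; have dp := primitive_derive chh xab.
    by rewrite /G /dG /E; apply: is_derive_eq; rewrite /GRing.scale/=; ring.
  - move=> x xab; rewrite /dG /E subr_le0.
    have xab' : x \in `[a, b] by exact: subset_itv_oo_cc.
    apply: (@le_trans _ _ (expR (- (L * (x - a))) * (h x * h x))).
      rewrite ler_pM2l ?expR_gt0// /L.
      have : 0 <= (v x + h x) ^+ 2 by exact: sqr_ge0.
      have := qM _ xab'; rewrite ler_norml => /andP[q1 q2].
      have : 0 <= (u x + v x) ^+ 2 by exact: sqr_ge0.
      have : 0 <= (u x - v x) ^+ 2 by exact: sqr_ge0.
      move: (u x) (v x) (h x) (q x) q1 q2 => U V H Q q1 q2 i1 i2 i3.
      have : 0 <= (M + Q) * (U - V) ^+ 2 by rewrite mulr_ge0//; lra.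
      have : 0 <= (M - Q) * (U + V) ^+ 2 by rewrite mulr_ge0//; lra.
      rewrite !expr2 in i1 i2 i3 *; nra.
    rewrite ler_piMl// -?expr2 ?sqr_ge0// -expR0 ler_expR oppr_le0.
    by rewrite mulr_ge0 ?ltW// subr_gt0; move: xab; rewrite in_itv/= => /andP[].
move=> x xab; have := GG _ xab.
rewrite /G primitive_id subr0 subrr mulr0 oppr0 expR0 mul1r lerBlDr.
rewrite expRN mulrC ler_pdivrMr ?expR_gt0// -/(E x) -/(E a) => /le_trans; apply.
move: xab; rewrite in_itv/= => /andP[ax xb].
have E0 : 0 <= E a by rewrite addr_ge0// sqr_ge0.
rewrite mulrC ler_pM ?expR_ge0//.
- by rewrite addr_ge0// /primitive Rintegral_ge0// => t _; rewrite -expr2 sqr_ge0.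
- by rewrite ler_expR ler_pM2l// lerB.
rewrite lerD2l /primitive /Rintegral fine_le//.
- apply: integrable_fin_num => //; apply: integrableS (within_continuous_integrable chh) => //.
  by apply: subset_itvl; rewrite bnd_simp.
- by apply: integrable_fin_num => //; exact: within_continuous_integrable.
- apply: ge0_subset_integral => //.
  + by case/integrableP : (within_continuous_integrable chh).
  + by move=> t _; rewrite lee_fin -expr2 sqr_ge0.
  + by apply: subset_itvl; rewrite bnd_simp.
Qed.

End Ode.

(** * Solution of initial value problems by Picard iteration *)

Section Picard.
Context (R : realType).
Notation mu := (@lebesgue_measure R).
Context (a b : R) (ab : a < b).

Lemma primitiveB f g : {within `[a, b], continuous f} ->
  {within `[a, b], continuous g} -> {in `[a, b], forall x,
  primitive a (fun t => f t - g t) x = primitive a f x - primitive a g x}.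
Proof.
move=> cf cg x; rewrite in_itv/= => /andP[ax xb].
have sub : `[a, x] `<=` `[a, b] by apply: subset_itvl; rewrite bnd_simp.
rewrite /primitive RintegralB//.
- exact: integrableS (within_continuous_integrable cf).
- exact: integrableS (within_continuous_integrable cg).
Qed.

(** Each integration gains a factor [1 / L] against the exponential weight, the source of the
    contraction below. *)
Lemma primitive_expR_bound L K f : 0 < L -> {within `[a, b], continuous f} ->
  {in `[a, b], forall x, `|f x| <= K * expR (L * (x - a))} ->
  {in `[a, b], forall x, `|primitive a f x| <= K / L * expR (L * (x - a))}.
Proof.
move=> L0 cf fK.
have K0 : 0 <= K.
  have := fK a; rewrite in_itv/= lexx ltW// subrr mulr0 expR0 mulr1 => /(_ isT).
  exact: le_trans.
have ce : {within `[a, b], continuous (fun x => K / L * expR (L * (x - a)))}.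
  apply: within_continuousT => x; apply: cvgMl_tmp.
  apply: (@continuous_comp _ _ _ (fun y => L * (y - a)) expR);
    last exact: continuous_expR.
  by apply: cvgMl_tmp; apply: cvgB; [exact: cvg_id|exact: cvg_cst].
have cp := primitive_continuous (ltW ab) cf.
have KL0 : 0 <= K / L by rewrite divr_ge0// ltW.
have e1 y : K / L * (expR (L * (y - a)) * L) = K * expR (L * (y - a)).
  by field; rewrite gt_eqF.
have ineq (s : R) : `|s| = 1 ->
    {in `[a, b], forall x, s * primitive a f x - K / L * expR (L * (x - a)) <= 0}.
  move=> s1 x xab.
  apply: (@le_trans _ _ (s * primitive a f a - K / L * expR (L * (a - a)))); last first.
    by rewrite primitive_id mulr0 sub0r oppr_le0 subrr mulr0 expR0 mulr1.
  move: x xab; apply: (@derive_le0_le _ a b _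
    (fun x => s * f x - K * expR (L * (x - a)))); first exact: ltW.
  - apply: within_continuousB => //; apply: within_continuousM => //.
    exact: within_continuous_cst.
  - move=> x xab; have ? := primitive_derive cf xab.
    apply: is_derive_eq; rewrite /GRing.scale/= -e1; ring.
  - move=> x xab; rewrite subr_le0 (le_trans (ler_norm _))// normrM s1 mul1r.
    by apply: fK; exact: subset_itv_oo_cc.
move=> x xab; have := ineq 1 (normr1 _) x xab; have := ineq (-1) (normrN1 _) x xab.
by rewrite mul1r mulN1r ler_norml => i1 i2; apply/andP; split; lra.
Qed.

Context (q h : R -> R) (A0 B0 : R).
Hypothesis cq : {within `[a, b], continuous q}.
Hypothesis ch : {within `[a, b], continuous h}.

Definition picard_derivative u x := B0 + primitive a (fun t => q t * u t - h t) x.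
Definition picard u x := A0 + primitive a (picard_derivative u) x.

Lemma picard_rhs_continuous u : {within `[a, b], continuous u} ->
  {within `[a, b], continuous (fun t => q t * u t - h t)}.
Proof. by move=> cu; apply: within_continuousB => //; exact: within_continuousM. Qed.

Lemma picard_derivative_continuous u : {within `[a, b], continuous u} ->
  {within `[a, b], continuous (picard_derivative u)}.
Proof.
move=> cu; apply: within_continuousD; first exact: within_continuous_cst.
exact: primitive_continuous (ltW ab) (picard_rhs_continuous cu).
Qed.

Lemma picard_continuous u : {within `[a, b], continuous u} ->
  {within `[a, b], continuous (picard u)}.
Proof.
move=> cu; apply: within_continuousD; first exact: within_continuous_cst.
exact: primitive_continuous (ltW ab) (picard_derivative_continuous cu).
Qed.

(* The exponential weight makes the Picard map a contraction on the whole
   interval. *)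
Lemma picard_contract : exists2 L, 0 < L & forall u w K,
  {within `[a, b], continuous u} -> {within `[a, b], continuous w} ->
  {in `[a, b], forall x, `|u x - w x| <= K * expR (L * (x - a))} ->
  {in `[a, b], forall x, `|picard u x - picard w x| <= K / 2 * expR (L * (x - a))}.
Proof.
have [M M0 qM] := within_continuous_bounded cq.
(* Two integrations turn the bound [K] into [M K / L^2], and [L^2 = (2 M + 1)^2 >= 2 M] makes this
   at most [K / 2]. *)
pose L := 2 * M + 1; have L0 : 0 < L by rewrite /L; lra.
exists L => // u w K cu cw uwK x xab.
have c1 := picard_rhs_continuous cu; have c2 := picard_rhs_continuous cw.
have c3 := picard_derivative_continuous cu.
have c4 := picard_derivative_continuous cw.
have K0 : 0 <= K.
  have := uwK a; rewrite in_itv/= lexx ltW// subrr mulr0 expR0 mulr1 => /(_ isT).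
  exact: le_trans.
have b1 : {in `[a, b], forall x,
    `|(q x * u x - h x) - (q x * w x - h x)| <= M * K * expR (L * (x - a))}.
  move=> y yab; rewrite (_ : _ - _ - _ = q y * (u y - w y)); last by ring.
  by rewrite normrM -mulrA ler_pM//; [exact: qM|exact: uwK].
have b2 : {in `[a, b], forall x,
    `|picard_derivative u x - picard_derivative w x| <= M * K / L * expR (L * (x - a))}.
  move=> y yab; rewrite /picard_derivative opprD addrACA subrr add0r -primitiveB//.
  by move: y yab; apply: primitive_expR_bound => //; exact: within_continuousB.
rewrite /picard opprD addrACA subrr add0r -primitiveB//.
apply: (@le_trans _ _ (M * K / L / L * expR (L * (x - a)))).
  move: x xab; apply: primitive_expR_bound => //; exact: within_continuousB.
rewrite ler_wpM2r ?expR_ge0// -mulrA -invfM ler_pdivrMr ?mulr_gt0//.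
rewrite mulrAC ler_pdivlMr// (mulrC M) -!mulrA ler_wpM2l// /L; nra.
Qed.

Lemma ode_exists : exists u v, [/\ ode a b q u v h, u a = A0 & v a = B0].
Proof.
have [L L0 HL] := picard_contract.
pose w n := iter n picard (fun=> 0).
have cw n : {within `[a, b], continuous (w n)}.
  by elim: n => [|n IH]; [exact: within_continuous_cst|exact: picard_continuous].
have [K K0 HK] := within_continuous_bounded (cw 1%N).
have exp1 x : x \in `[a, b] -> 1 <= expR (L * (x - a)).
  rewrite in_itv/= => /andP[ax _].
  by rewrite -expR0 ler_expR mulr_ge0 ?subr_ge0// ltW.
pose D := expR (L * (b - a)); have D0 : 0 < D by exact: expR_gt0.
have expD x : x \in `[a, b] -> expR (L * (x - a)) <= D.
  by rewrite in_itv/= => /andP[_ xb]; rewrite ler_expR ler_pM2l// lerB.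
have w_step n : {in `[a, b], forall x,
    `|w n.+1 x - w n x| <= K / 2 ^+ n * expR (L * (x - a))}.
  elim: n => [|n IH] x xab.
    rewrite expr0 divr1 subr0 (le_trans (HK _ xab))// ler_peMr ?exp1//.
    exact: ltW.
  by rewrite exprSr invfM mulrA; exact: (HL _ _ _ (cw n.+1) (cw n) IH x xab).
have w_dist n k : {in `[a, b], forall x,
    `|w (n + k)%N x - w n x| <= K * D * (2 / 2 ^+ n)}.
  (* The bracket is the geometric sum of [1 / 2^i] over [n <= i < n + k]; keeping its exact value
     lets the induction on [k] close. *)
  move=> x xab; apply: (@le_trans _ _ (K * D * (2 / 2 ^+ n - 2 / 2 ^+ (n + k)))).
    elim: k => [|k IH]; first by rewrite addn0 !subrr normr0 mulr0.
    rewrite addnS -(subrK (w (n + k)%N x) (w _ x)) -addrA (le_trans (ler_normD _ _))//.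
    rewrite (_ : 2 / 2 ^+ n - _ = 1 / 2 ^+ (n + k) + (2 / 2 ^+ n - 2 / 2 ^+ (n + k))); last first.
      by rewrite exprSr; field; rewrite !expf_neq0 ?pnatr_eq0.
    rewrite mulrDr lerD// (le_trans (w_step _ _ xab))// div1r mulrAC.
    by rewrite ler_pM2r ?invr_gt0 ?exprn_gt0// ler_pM2l// expD.
  rewrite ler_pM2l ?mulr_gt0// lerBlDr lerDl divr_ge0// exprn_ge0//.
have small (e : R) : 0 < e -> exists n, K * D * (2 / 2 ^+ n) < e.
  move=> e0; have : (K * D * 2) * 2^-1 ^+ n @[n --> \oo] --> K * D * 2 * 0.
    by apply: cvgMl_tmp; apply: cvg_expr; rewrite gtr0_norm ?invf_lt1// ?ltr1n.
  rewrite mulr0 => /cvgrPdist_lt/(_ _ e0)[n _ /(_ n (leqnn n))/=].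
  rewrite sub0r normrN => /(le_lt_trans (ler_norm _)) H.
  by exists n; rewrite mulrA -exprVn.
pose u x := limn (w^~ x).
have w_cvg x : x \in `[a, b] -> w^~ x @ \oo --> u x.
  move=> xab; apply: cauchy_cvg; apply: cauchy_exP => e e0.
  have [n ne] := small _ e0; exists (w n x), n => // m /= nm.
  rewrite /ball/= distrC (le_lt_trans _ ne)//.
  by rewrite -(subnKC nm); exact: w_dist.
have wu n : {in `[a, b], forall x, `|u x - w n x| <= K * D * (2 / 2 ^+ n)}.
  move=> x xab.
  have wux : `|w m x - w n x| @[m --> \oo] --> `|u x - w n x|.
    by apply: cvg_norm; apply: cvgB (w_cvg _ xab) _; exact: cvg_cst.
  apply: (cvgr_to_le wux).
  by exists n => // m /= nm; rewrite -(subnKC nm); exact: w_dist.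
have cu : {within `[a, b], continuous u}.
  apply/subspace_continuousP => x /= xab; apply/cvgrPdist_lt => e e0.
  have [n ne] := small (e / 3) (divr_gt0 e0 (ltr0n _ 3)).
  have /subspace_continuousP/(_ _ xab)/cvgrPdist_lt/(_ (e / 3)) := cw n.
  rewrite divr_gt0// => /(_ isT) wn; near=> y.
  have yab : y \in `[a, b] by near: y; exact: withinT.
  have := le_lt_trans (wu n _ xab) ne; have := le_lt_trans (wu n _ yab) ne.
  have : `|w n x - w n y| < e / 3 by near: y.
  rewrite !(ltr_distl, ler_distl, ltr_norml, ler_norml) /from_subspace; lra.
(* Both sides are close to [w n.+1]: the left by uniform convergence, the right because [picard]
   contracts. *)
have uP x : x \in `[a, b] -> u x = picard u x.
  move=> xab; apply/eqP; rewrite -subr_eq0 -normr_eq0 eq_le normr_ge0 andbT.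
  apply/ler_addgt0Pr => e e0; rewrite add0r.
  have [|n ne] := small (e / (1 + D)); first by rewrite divr_gt0// addr_gt0.
  have b1 := wu n.+1 _ xab.
  have b2 : `|picard (w n) x - picard u x| <= K * D * (2 / 2 ^+ n) / 2 * expR (L * (x - a)).
    apply: HL => // y yab; rewrite distrC (le_trans (wu n _ yab))//.
    by rewrite ler_peMr ?exp1// mulr_ge0 ?divr_ge0 ?exprn_ge0// mulr_ge0// ltW.
  have b3 := expD _ xab.
  set X := K * D * (2 / 2 ^+ n) in ne b2.
  have X0 : 0 <= X by rewrite /X mulr_ge0 ?divr_ge0 ?exprn_ge0// mulr_ge0// ltW.
  have X1 : K * D * (2 / 2 ^+ n.+1) <= X.
    rewrite /X exprSr ler_pM2l ?mulr_gt0// ler_pM2l// lef_pV2 ?posrE ?mulr_gt0 ?exprn_gt0//.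
    by rewrite ler_peMr ?exprn_ge0// ler1n.
  rewrite -(subrK (w n.+1 x) (u x)) -addrA (le_trans (ler_normD _ _))//.
  rewrite ltr_pdivlMr ?addr_gt0// in ne.
  apply: le_trans (ltW ne); rewrite mulrDr mulr1 lerD//; first exact: le_trans X1.
  by apply: le_trans b2 _; rewrite ler_pM ?expR_ge0 ?divr_ge0// ler_pdivrMr//; lra.
(* [picard u] agrees with [u] on the interval and is differentiable by construction. *)
exists (picard u), (picard_derivative u); split.
- split => //; first exact: picard_continuous.
    exact: picard_derivative_continuous.
  move=> x xab; have xab' : x \in `[a, b] by exact: subset_itv_oo_cc.
  have ? := primitive_derive (picard_derivative_continuous cu) xab.
  have ? := primitive_derive (picard_rhs_continuous cu) xab.
  split.
    suff : is_derive x (1 : R) (fun y => A0 + primitive a (picard_derivative u) y)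
      (picard_derivative u x) by [].
    by apply: is_derive_eq; rewrite add0r mul1r.
  suff : is_derive x (1 : R)
      (fun y => B0 + primitive a (fun t => q t * u t - h t) y) (q x * picard u x - h x) by [].
  by apply: is_derive_eq; rewrite add0r mul1r -uP.
- by rewrite /picard primitive_id addr0.
- by rewrite /picard_derivative primitive_id addr0.
Unshelve. all: by end_near. Qed.

End Picard.

(** * Density of smooth functions vanishing at the end points *)

Section Clamp.
Context (R : realType).

(** For [M >= 0], truncation to [[-M, M]]; written with norms so that continuity is immediate. *)
Definition clamp (M x : R) : R := (`|x + M| - `|x - M|) / 2.

Lemma clampP M x : 0 <= M ->
  [\/ M <= x /\ clamp M x = M, x <= - M /\ clamp M x = - M |
      - M <= x <= M /\ clamp M x = x].
Proof.
move=> M0; rewrite /clamp.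
have [xM|xM] := leP M x.
  by apply: Or31; split => //; rewrite !ger0_norm ?subr_ge0 ?addr_ge0 ?(le_trans M0)//; lra.
have [Mx|Mx] := leP x (- M).
  by apply: Or32; split => //; rewrite !ler0_norm; lra.
by apply: Or33; split; [lra|rewrite ger0_norm ?ler0_norm; lra].
Qed.

Lemma clamp_le M x : 0 <= M -> `|clamp M x| <= M.
Proof. by move=> M0; rewrite ler_norml; case: (clampP x M0) => -[? ->]; lra. Qed.

Lemma clamp_lipschitz M x y : 0 <= M -> `|clamp M x - clamp M y| <= `|x - y|.
Proof.
move=> M0.
(* For [lra] the norm [|x - y|] is an atom, so the two inequalities that it needs are inserted as
   premises. *)
have -> : `|clamp M x - clamp M y| <= `|x - y| =
    (x - y <= `|x - y|) ==> (y - x <= `|x - y|) ==> (`|clamp M x - clamp M y| <= `|x - y|).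
  by rewrite ler_norm -(distrC y) ler_norm.
rewrite ler_norml; apply/implyP => i1; apply/implyP => i2.
by case: (clampP x M0) => -[? ->]; case: (clampP y M0) => -[? ->]; lra.
Qed.

Lemma clamp_id M x : `|x| <= M -> clamp M x = x.
Proof.
move=> xM; have M0 : 0 <= M by apply: le_trans xM.
by move: xM; rewrite ler_norml; case: (clampP x M0) => -[? ->]; lra.
Qed.

Lemma clamp_sub_le M x : 0 <= M -> `|x - clamp M x| <= `|x|.
Proof.
move=> M0; case: (clampP x M0) => -[xM ->].
- by rewrite ger0_norm ?subr_ge0// ger0_norm; lra.
- by rewrite ler0_norm ?ler0_norm; lra.
- by rewrite subrr normr0.
Qed.

Lemma clamp_continuous M : continuous (clamp M).
Proof.
move=> x; apply: cvgMr_tmp; apply: cvgB; apply: cvg_norm.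
  by apply: cvgD; [exact: cvg_id|exact: cvg_cst].
by apply: cvgB; [exact: cvg_id|exact: cvg_cst].
Qed.

End Clamp.

(** * Truncation, cutoff and smoothing of square integrable functions *)

Section SquareIntegrable.
Context (R : realType).
Notation mu := (@lebesgue_measure R).
Context (a b : R) (ab : a < b).
Implicit Types f g u : R -> R.

Lemma Rintegral_oo_cc f : mu.-integrable `[a, b] (EFin \o f) ->
  \int[mu]_(x in `[a, b]) f x = \int[mu]_(x in `]a, b[) f x.
Proof.
move=> intf; rewrite -Rintegral_itv_obnd_cbnd; last first.
  by apply: integrableS intf => //; exact: subset_itv_oc_cc.
rewrite -Rintegral_itv_bndo_bndc//.
by apply: integrableS intf => //; exact: subset_itv_oo_cc.
Qed.

(** Convergence is asked only in the open interval because the cutoffs used later vanish at the end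
    points. *)
Lemma Rintegral_dominated_cvg0 (d : nat -> R -> R) (K : R -> R) :
  (forall n, measurable_fun `[a, b] (d n)) -> mu.-integrable `[a, b] (EFin \o K) ->
  (forall n, {in `[a, b], forall x, `|d n x| <= K x}) ->
  {in `]a, b[, forall x, d n x @[n --> \oo] --> (0 : R)} ->
  \int[mu]_(x in `[a, b]) d n x @[n --> \oo] --> (0 : R).
Proof.
move=> md iK dK dcvg.
have id n : mu.-integrable `[a, b] (EFin \o d n).
  apply: le_integrable iK => //; first by apply/measurable_EFinP; exact: md.
  by move=> x xab; rewrite /= lee_fin (le_trans (dK _ _ xab))// ler_norm.
have sub : `]a, b[ `<=` `[a, b] by exact: subset_itv_oo_cc.
have m1 n : measurable_fun `]a, b[ (EFin \o d n).
  by apply/measurable_EFinP; apply: measurable_funS (md n).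
have m3 : {ae mu, forall x, `]a, b[%classic x -> (EFin \o d n0) x @[n0 --> \oo] --> (0%E : \bar R)}.
  by apply: aeW => x xab /=; apply/cvg_EFin; [exact: nearW|exact: dcvg].
have m4 : mu.-integrable `]a, b[ (EFin \o K) by exact: integrableS iK.
have m5 : {ae mu, forall x n, `]a, b[%classic x -> (`|(EFin \o d n) x| <= (EFin \o K) x)%E}.
  by apply: aeW => x n xab /=; rewrite lee_fin; apply: dK; exact: sub.
have [_ _] := @dominated_convergence _ _ _ mu _ (measurable_itv `]a, b[)
  (fun n => EFin \o d n) (cst 0%E) (EFin \o K) m1 (measurable_cst _) m3 m4 m5.
rewrite integral0 => /fine_cvg.
suff -> : (fun n => \int[mu]_(x in `[a, b]) d n x) =
    (fun n => \int[mu]_(x in `]a, b[) d n x) by [].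
by apply/funext => n; exact: Rintegral_oo_cc.
Qed.

Definition square_int f : Prop := measurable_fun `[a, b] f /\
  mu.-integrable `[a, b] (EFin \o (fun x => f x * f x)).

Lemma square_int_bounded f M : measurable_fun `[a, b] f ->
  {in `[a, b], forall x, `|f x| <= M} -> square_int f.
Proof.
move=> mf fM; split => //; apply: measurable_bounded_integrable => //.
- by rewrite /= lebesgue_measure_itv/= lte_fin ab -EFinD ltry.
- exact: measurable_funM.
exists (M * M); split; first exact: num_real.
move=> K MK x xab; rewrite /= normrM; apply: le_trans (ltW MK).
by apply: ler_pM => //; exact: fM.
Qed.

Lemma square_int_continuous f : {within `[a, b], continuous f} -> square_int f.
Proof.
move=> cf; have [M _ fM] := within_continuous_bounded cf.
apply: (square_int_bounded _ fM).
by have /integrableP[/measurable_EFinP] := within_continuous_integrable cf.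
Qed.

Lemma square_intB f g : square_int f -> square_int g -> square_int (fun x => f x - g x).
Proof.
move=> [mf If] [mg Ig]; have mfg : measurable_fun `[a, b] (fun x => f x - g x).
  exact: measurable_funB.
split => //.
have : mu.-integrable `[a, b]
    (fun x => 2%:E * ((f x * f x)%:E + (g x * g x)%:E))%E.
  by apply: integrableZl => //; exact: integrableD If Ig.
apply: le_integrable => //; first by apply/measurable_EFinP; exact: measurable_funM.
move=> x _; rewrite /= lee_fin ger0_norm -?expr2 ?sqr_ge0//.
apply: le_trans (ler_norm _).
by have := sqr_ge0 (f x + g x); rewrite !expr2; lra.
Qed.

Definition dist2 f g := \int[mu]_(x in `[a, b]) ((f x - g x) * (f x - g x)).

Lemma dist2_trans f g u : square_int f -> square_int g -> square_int u ->
  dist2 f u <= 2 * (dist2 f g + dist2 g u).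
Proof.
move=> sf sg su.
have [_ i1] := square_intB sf su; have [_ i2] := square_intB sf sg.
have [_ i3] := square_intB sg su.
have i4 : mu.-integrable `[a, b] (fun x =>
    (((f x - g x) * (f x - g x))%:E + ((g x - u x) * (g x - u x))%:E))%E.
  exact: integrableD i2 i3.
rewrite /dist2 -RintegralD// -RintegralZl//.
apply: le_Rintegral => //.
  have : mu.-integrable `[a, b] (fun x => 2%:E *
      (((f x - g x) * (f x - g x))%:E + ((g x - u x) * (g x - u x))%:E))%E.
    exact: integrableZl.
  by exact: eq_integrable.
move=> x _; have := sqr_ge0 ((f x - g x) - (g x - u x)); rewrite !expr2; lra.
Qed.

Lemma dist2_truncate f : square_int f ->
  dist2 f (fun x => clamp n%:R (f x)) @[n --> \oo] --> (0 : R).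
Proof.
move=> [mf If]; apply: (Rintegral_dominated_cvg0 _ If).
- move=> n; apply: measurable_funM; apply: measurable_funB => //;
  apply: measurableT_comp => //; apply: continuous_measurable_fun;
  exact: clamp_continuous.
- move=> n x xab; rewrite normrM -[leRHS]ger0_norm -?expr2 ?sqr_ge0// normrX expr2.
  by apply: ler_pM => //; exact: clamp_sub_le.
move=> x xab; apply: cvg_near_cst; near=> n.
rewrite clamp_id ?subrr ?mul0r//; near: n; exact: nbhs_infty_ger.
Unshelve. all: by end_near. Qed.

(** Approximation in the mean suffices for a bounded function: once the approximant is clamped to
    [[-M, M]], the squared difference is at most [2 M |f - g|]. *)
Lemma dist2_continuous_approx f M eps : measurable_fun `[a, b] f ->
  0 < M -> {in `[a, b], forall x, `|f x| <= M} -> 0 < eps ->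
  exists g, [/\ continuous g, forall x, `|g x| <= M & dist2 f g < eps].
Proof.
move=> mf M0 fM eps0; have [_ If2] := square_int_bounded mf fM.
have If : mu.-integrable `[a, b] (EFin \o f).
  apply: measurable_bounded_integrable => //.
    by rewrite /= lebesgue_measure_itv/= lte_fin ab -EFinD ltry.
  exists M; split; first exact: num_real.
  by move=> K MK x xab; apply: le_trans (ltW MK); exact: fM.
have abfin : (mu `[a, b] < +oo)%E.
  by rewrite /= lebesgue_measure_itv/= lte_fin ab -EFinD ltry.
have [g_ [cg Ig gcvg]] := approximation_continuous_integrable (measurable_itv _) abfin If.
have IB n : mu.-integrable `[a, b] (EFin \o (fun x => f x - g_ n x)).
  apply: eq_integrable (integrableB _ If (Ig n)) => // x _.
have {gcvg} : \int[mu]_(x in `[a, b]) `|f x - g_ n x| @[n --> \oo] --> (0 : R).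
  exact: fine_cvg gcvg.
move/cvgrPdist_lt => /(_ (eps / (2 * M))).
rewrite divr_gt0 ?mulr_gt0// => /(_ isT)[n _ /(_ n (leqnn n))/=].
rewrite sub0r normrN => /(le_lt_trans (ler_norm _)) gn.
exists (fun x => clamp M (g_ n x)); split.
- by move=> x; apply: (@continuous_comp _ _ _ (g_ n) (clamp M));
    [exact: cg|exact: clamp_continuous].
- by move=> x; exact/clamp_le/ltW.
rewrite ltr_pdivlMr ?mulr_gt0// mulrC -RintegralZl// in gn; last first.
  by have := integrable_abse (IB n); apply: eq_integrable => // x _.
apply: le_lt_trans gn; apply: le_Rintegral => //.
- have mc : measurable_fun `[a, b] (fun x => clamp M (g_ n x)).
    apply: measurable_funTS; apply: continuous_measurable_fun => x.
    by apply: (@continuous_comp _ _ _ (g_ n) (clamp M));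
      [exact: cg|exact: clamp_continuous].
  apply: (square_intB (square_int_bounded mf fM) _).2.
  by apply: (@square_int_bounded _ M) => // x _; exact/clamp_le/ltW.
- have : mu.-integrable `[a, b] (fun x => (2 * M)%:E * `|(f x - g_ n x)%:E|)%E.
    by apply: integrableZl => //; exact: integrable_abse (IB n).
  by apply: eq_integrable => // x _; rewrite /= -EFinM.
move=> x xab; have fc : clamp M (f x) = f x by apply: clamp_id; exact: fM.
apply: le_trans (ler_norm _) _; rewrite normrM; apply: ler_pM => //.
  rewrite (le_trans (ler_normB _ _))// mulr_natl mulr2n lerD ?fM//.
  exact/clamp_le/ltW.
by rewrite -{1}fc; exact/clamp_lipschitz/ltW.
Qed.

Definition twice_diff (u v w : R -> R) : Prop :=
  [/\ {within `[a, b], continuous u}, {within `[a, b], continuous v},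
      {within `[a, b], continuous w} &
      {in `]a, b[, forall x : R, is_derive x (1 : R) u (v x) /\
                                 is_derive x (1 : R) v (w x)}].

Lemma twice_diffM u v w p q r : twice_diff u v w -> twice_diff p q r ->
  twice_diff (fun x => u x * p x) (fun x => v x * p x + u x * q x)
    (fun x => w x * p x + 2 * v x * q x + u x * r x).
Proof.
move=> [cu cv cw d1] [cp cq cr d2].
have M f1 f2 : {within `[a, b], continuous f1} -> {within `[a, b], continuous f2} ->
  {within `[a, b], continuous (fun x => f1 x * f2 x)} by exact: within_continuousM.
split; [exact: M|by apply: within_continuousD; exact: M| |].
  apply: within_continuousD; last exact: M.
  apply: within_continuousD; first exact: M.
  by apply: (M (fun x => 2 * v x)) => //; apply: M => //; exact: within_continuous_cst.
move=> x xab; have [? ?] := d1 _ xab; have [? ?] := d2 _ xab.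
by split; apply: is_derive_eq; rewrite /GRing.scale/=; ring.
Qed.

Lemma is_derive_continuous (f : R -> R) (x d : R) : is_derive x (1 : R) f d ->
  {for x, continuous f}.
Proof. by move=> [df _]; apply/differentiable_continuous/derivable1_diffP. Qed.

Lemma twice_diffT u v w : (forall x : R, is_derive x (1 : R) u (v x)) ->
  (forall x : R, is_derive x (1 : R) v (w x)) -> continuous w -> twice_diff u v w.
Proof.
move=> du dv cw; split => //.
- by apply: within_continuousT => x; exact: is_derive_continuous.
- by apply: within_continuousT => x; exact: is_derive_continuous.
- exact: within_continuousT.
Qed.

Definition cutoff_base (x : R) : R := (x - a) * (b - x) / (b - a) ^+ 2.
(** A polynomial that tends to 1 inside as [n] grows. The square of [cutoff_base] makes the first
    derivative vanish at the end points too. *)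
Definition cutoff n x : R := 1 - (1 - cutoff_base x ^+ 2) ^+ n.+2.

Lemma cutoff_base_itv : {in `]a, b[, forall x, 0 < cutoff_base x < 1}.
Proof.
move=> x; rewrite in_itv/= => /andP[ax xb]; rewrite /cutoff_base.
have ba : 0 < (b - a) ^+ 2 by rewrite exprn_gt0// subr_gt0.
rewrite divr_gt0 ?mulr_gt0 ?subr_gt0//= ltr_pdivrMr// mul1r expr2.
by apply: ltr_pM; rewrite ?subr_ge0 ?ltW//; lra.
Qed.

Lemma cutoff_base_cc : {in `[a, b], forall x, 0 <= cutoff_base x <= 1}.
Proof.
move=> x; rewrite in_itv/= => /andP[ax xb]; rewrite /cutoff_base.
have ba : 0 < (b - a) ^+ 2 by rewrite exprn_gt0// subr_gt0.
apply/andP; split.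
  by apply: divr_ge0; rewrite ?(ltW ba)// mulr_ge0// subr_ge0.
by rewrite ler_pdivrMr// mul1r expr2; apply: ler_pM; rewrite ?subr_ge0//; lra.
Qed.

Lemma cutoff_cvg : {in `]a, b[, forall x, cutoff n x @[n --> \oo] --> (1 : R)}.
Proof.
move=> x /cutoff_base_itv /andP[r0 r1].
rewrite -[X in _ --> X]subr0; apply: cvgB; first exact: cvg_cst.
have : (1 - cutoff_base x ^+ 2) ^+ n @[n --> \oo] --> (0 : R).
  apply: cvg_expr; rewrite ger0_norm ?subr_ge0 ?expr_le1 ?(ltW r0) ?(ltW r1)//.
  by rewrite gtrBl exprn_gt0.
by rewrite -(cvg_shiftn 2); under eq_fun do rewrite addn2.
Qed.

Lemma cutoff_le1 n : {in `[a, b], forall x, 0 <= cutoff n x <= 1}.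
Proof.
move=> x /cutoff_base_cc /andP[r0 r1]; rewrite /cutoff.
have p0 : 0 <= 1 - cutoff_base x ^+ 2 by rewrite subr_ge0 expr_le1.
have p1 : 1 - cutoff_base x ^+ 2 <= 1 by rewrite gerBl exprn_ge0.
by rewrite subr_ge0 exprn_ile1//= gerBl exprn_ge0.
Qed.

Lemma twice_diff_power (p p' p'' : R -> R) n :
  (forall x : R, is_derive x (1 : R) p (p' x)) ->
  (forall x : R, is_derive x (1 : R) p' (p'' x)) -> continuous p'' ->
  twice_diff (fun x => 1 - p x ^+ n.+2) (fun x => - (n.+2%:R * p x ^+ n.+1 * p' x))
    (fun x => - (n.+2%:R * (n.+1%:R * p x ^+ n * p' x * p' x + p x ^+ n.+1 * p'' x))).
Proof.
move=> dp dp' cp''.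
have dpn m (x : R) : is_derive x (1 : R) (fun y => p y ^+ m.+1)
    (m.+1%:R * p x ^+ m * p' x).
  have -> : (fun y => p y ^+ m.+1) = (p : R -> R) ^+ m.+1.
    by apply/funext => y; rewrite exprfctE.
  by have ? := dp x; apply: is_derive_eq.
have dB (P : R -> R) (x dP : R) : is_derive x (1 : R) P dP ->
    is_derive x (1 : R) (fun y => 1 - P y) (- dP).
  by move=> ?; apply: is_derive_eq; rewrite /GRing.scale/=; ring.
have dM (P Q : R -> R) (k x dP dQ : R) : is_derive x (1 : R) P dP ->
    is_derive x (1 : R) Q dQ ->
    is_derive x (1 : R) (fun y => - (k * P y * Q y)) (- (k * (dP * Q x + P x * dQ))).
  by move=> ? ?; apply: is_derive_eq; rewrite /GRing.scale/=; ring.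
apply: (twice_diffT (fun x => dB _ _ _ (dpn n.+1 x))
  (fun x => dM _ _ _ _ _ _ (dpn n x) (dp' x))) => x.
- have cp := is_derive_continuous (dp x); have cp' := is_derive_continuous (dp' x).
  have cpn m : {for x, continuous (fun y => p y ^+ m)}.
    by apply: (@continuous_comp _ _ _ p (fun y => y ^+ m)) => //; exact: exprn_continuous.
  apply: cvgN; apply: cvgMl_tmp; apply: cvgD.
    by apply: cvgM => //; apply: cvgM => //; apply: cvgMl_tmp; exact: cpn.
  by apply: cvgM; [exact: cpn|exact: cp''].
Qed.

Lemma cutoff_twice_diff n : exists v w, [/\ twice_diff (cutoff n) v w,
  cutoff n a = 0, cutoff n b = 0, v a = 0 & v b = 0].
Proof.
pose k : R := ((b - a) ^+ 2)^-1.
have dr (x : R) : is_derive x (1 : R) cutoff_base ((a + b - 2 * x) * k).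
  apply: is_derive_eq; rewrite /GRing.scale/= /k; ring.
have dp (x : R) : is_derive x (1 : R) (fun y => 1 - cutoff_base y ^+ 2)
    (- (2 * cutoff_base x * ((a + b - 2 * x) * k))).
  by have := dr x; move: cutoff_base => r ?; apply: is_derive_eq; rewrite /GRing.scale/=; ring.
have dp' (x : R) : is_derive x (1 : R)
    (fun y => - (2 * cutoff_base y * ((a + b - 2 * y) * k)))
    (- (2 * ((a + b - 2 * x) * k * ((a + b - 2 * x) * k) - 2 * k * cutoff_base x))).
  by have := dr x; move: cutoff_base => r ?; apply: is_derive_eq; rewrite /GRing.scale/=; ring.
have cp'' : continuous (fun x : R =>
    - (2 * ((a + b - 2 * x) * k * ((a + b - 2 * x) * k) - 2 * k * cutoff_base x)) : R).
  move=> x; have := is_derive_continuous (dr x); move: cutoff_base => r cr.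
  have cl : (a + b - 2 * y) * k @[y --> x] --> (a + b - 2 * x) * k.
    apply: cvgMr_tmp; apply: cvgB; first exact: cvg_cst.
    by apply: cvgMl_tmp; exact: cvg_id.
  by apply: cvgN; apply: cvgMl_tmp; apply: cvgB; [exact: cvgM|exact: cvgMl_tmp].
have ra : cutoff_base a = 0 by rewrite /cutoff_base subrr !mul0r.
have rb : cutoff_base b = 0 by rewrite /cutoff_base subrr mulr0 mul0r.
eexists; eexists; split; first exact: (twice_diff_power n dp dp' cp'').
- by rewrite /cutoff ra expr0n subr0 expr1n subrr.
- by rewrite /cutoff rb expr0n subr0 expr1n subrr.
- by rewrite /= ra !(mulr0, mul0r) oppr0 mulr0 oppr0.
- by rewrite /= rb !(mulr0, mul0r) oppr0 mulr0 oppr0.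
Qed.

(** Applied to a second primitive of [g], this is a twice differentiable average of [g] over
    [[x, x + 2 h]]; it replaces convolution with a mollifier. *)
Definition second_difference (h : R) (F : R -> R) (x : R) : R :=
  (F (x + 2 * h) - 2 * F (x + h) + F x) / h ^+ 2.

Lemma is_derive_shift (F : R -> R) (k x d : R) : is_derive (x + k) (1 : R) F d ->
  is_derive x (1 : R) (fun y => F (y + k)) d.
Proof.
move=> dF; have dk : is_derive x (1 : R) (fun y => y + k) 1.
  by apply: is_derive_eq; rewrite addr0.
by have := is_derive1_comp (g := fun y => y + k) (x := x) dF dk; rewrite mulr1.
Qed.

Lemma second_difference_derive h (F F' : R -> R) x : is_derive x (1 : R) F (F' x) ->
  is_derive (x + h) (1 : R) F (F' (x + h)) ->
  is_derive (x + 2 * h) (1 : R) F (F' (x + 2 * h)) ->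
  is_derive x (1 : R) (second_difference h F) (second_difference h F' x).
Proof.
move=> d0 /is_derive_shift d1 /is_derive_shift d2.
have -> : second_difference h F =
    (fun y => (h ^+ 2)^-1 * (F (y + 2 * h) - 2 * F (y + h) + F y)).
  by apply/funext => y; rewrite [RHS]mulrC.
rewrite /second_difference [X in is_derive _ _ _ X]mulrC.
have dS (F1 F2 F3 : R -> R) (e1 e2 e3 : R) : is_derive x (1 : R) F1 e1 ->
    is_derive x (1 : R) F2 e2 -> is_derive x (1 : R) F3 e3 ->
    is_derive x (1 : R) (fun y => F2 y - 2 * F1 y + F3 y) (e2 - 2 * e1 + e3).
  by move=> ? ? ?; apply: is_derive_eq; rewrite /GRing.scale/=; ring.
have dM (P : R -> R) (k dP : R) : is_derive x (1 : R) P dP ->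
    is_derive x (1 : R) (fun y => k * P y) (k * dP).
  by move=> ?; apply: is_derive_eq.
exact: dM (dS _ _ _ _ _ _ d1 d2 d0).
Qed.

(** The mean value theorem twice: for [F (y + h) - F y], then for [F']. *)
Lemma second_difference_mean h (F F' F'' : R -> R) x lo hi : 0 < h ->
  {in `]lo, hi[, forall y : R, is_derive y (1 : R) F (F' y)} ->
  {in `]lo, hi[, forall y : R, is_derive y (1 : R) F' (F'' y)} ->
  lo < x -> x + 2 * h < hi ->
  exists2 y, x <= y <= x + 2 * h & second_difference h F x = F'' y.
Proof.
move=> h0 dF dF' lox xhi.
have mvt (G G' : R -> R) y : {in `]lo, hi[, forall t : R, is_derive t (1 : R) G (G' t)} ->
    lo < y -> y + h < hi -> exists2 z, y < z < y + h & G (y + h) - G y = G' z * h.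
  move=> dG loy yhi.
  have yyh : y < y + h by rewrite ltrDl.
  have [||z zy GE] := @MVT R G G' y (y + h) yyh.
  - move=> t; rewrite in_itv/= => /andP[yt th]; apply: dG.
    by rewrite in_itv/= (lt_trans loy yt) (lt_trans th yhi).
  - apply: derivable_within_continuous => t; rewrite in_itv/= => /andP[yt th].
    have [] // := dG t _; by rewrite in_itv/= (lt_le_trans loy yt) (le_lt_trans th yhi).
  by exists z; [move: zy; rewrite in_itv|rewrite GE addrAC subrr add0r].
have dP : {in `]lo, hi - h[, forall t : R,
    is_derive t (1 : R) (fun y => F (y + h) - F y) (F' (t + h) - F' t)}.
  move=> t; rewrite in_itv/= => /andP[lot thi].
  have ? : is_derive t (1 : R) F (F' t) by apply: dF; rewrite in_itv/=; lra.
  have ? : is_derive t (1 : R) (fun y => F (y + h)) (F' (t + h)).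
    by apply: is_derive_shift; apply: dF; rewrite in_itv/=; lra.
  by apply: is_derive_eq.
have dP' t : t \in `[x, x + h] -> is_derive t (1 : R) (fun y => F (y + h) - F y) (F' (t + h) - F' t).
  by rewrite in_itv/= => /andP[xt th]; apply: dP; rewrite in_itv/=; lra.
have xxh : x < x + h by rewrite ltrDl.
have dP'' : {in `]x, x + h[, forall t : R,
    is_derive t (1 : R) (fun y => F (y + h) - F y) (F' (t + h) - F' t)}.
  by move=> t tx; apply: dP'; exact: subset_itv_oo_cc.
have cP : {within `[x, x + h], continuous (fun y => F (y + h) - F y)}.
  by apply: derivable_within_continuous => t /dP'[].
have [z zx] := MVT xxh dP'' cP.
rewrite in_itv/= in zx; have [xz zxh] := andP zx.
have [|| y yz ->] := mvt F' F'' z dF'; [lra|lra|] => E.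
exists y; first lra.
apply: (mulIf (lt0r_neq0 (exprn_gt0 2 h0))); rewrite /second_difference divfK ?expf_neq0 ?gt_eqF//.
move: E; rewrite (_ : x + 2 * h = x + h + h); last by ring.
rewrite [x + h - x]addrAC subrr add0r expr2; lra.
Qed.

(** The approximants are second differences of a second primitive of [g], times cutoffs. They
    converge to [g] inside the interval and are bounded by [M], so dominated convergence applies. *)
Lemma smooth_approx g M eps : continuous g -> (forall x, `|g x| <= M) -> 0 < eps ->
  exists u v w, [/\ twice_diff u v w, [/\ u a = 0, u b = 0, v a = 0 & v b = 0] &
    dist2 g u < eps].
Proof.
move=> cg gM eps0.
(* The steps satisfy [h n <= 1], so [x + 2 * h n <= b + 2 < hi] for [x] in [[a, b]]. *)
pose lo := a - 1; pose hi := b + 3.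
have lohi : lo <= hi by rewrite /lo /hi; move: ab; lra.
have cgw : {within `[lo, hi], continuous g} by exact: within_continuousT.
pose G1 := primitive lo g; pose G2 := primitive lo G1.
have cG1 : {within `[lo, hi], continuous G1} by exact: primitive_continuous.
have dG1 : {in `]lo, hi[, forall y : R, is_derive y (1 : R) G1 (g y)}.
  exact: primitive_derive.
have dG2 : {in `]lo, hi[, forall y : R, is_derive y (1 : R) G2 (G1 y)}.
  exact: primitive_derive.
move: G1 G2 cG1 dG1 dG2 => G1 G2 _ dG1 dG2.
pose h n : R := n.+1%:R^-1.
have h0 n : 0 < h n by rewrite invr_gt0.
have h1 n : h n <= 1 by rewrite invf_le1 ?ler1n.
pose D n := second_difference (h n) G2.
have dD (F F' : R -> R) : {in `]lo, hi[, forall y : R, is_derive y (1 : R) F (F' y)} ->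
    forall n x, x \in `[a, b] ->
    is_derive x (1 : R) (second_difference (h n) F) (second_difference (h n) F' x).
  move=> dF n x; rewrite in_itv/= => /andP[ax xb].
  have := h1 n; have := h0 n => hn0 hn1.
  apply: second_difference_derive; apply: dF; rewrite in_itv/= /lo /hi; lra.
have tD n : twice_diff (D n) (second_difference (h n) G1) (second_difference (h n) g).
  split.
  - by apply: derivable_within_continuous => x /(dD _ _ dG2 n)[].
  - by apply: derivable_within_continuous => x /(dD _ _ dG1 n)[].
  - apply: within_continuousT => x; apply: cvgMr_tmp.
    have cgs k : {for x, continuous (fun y => g (y + k))}.
      apply: (@continuous_comp _ _ _ (fun y => y + k) g); last exact: cg.
      by apply: cvgD; [exact: cvg_id|exact: cvg_cst].
    apply: cvgD; last exact: cg.
    by apply: cvgB; [exact: cgs|apply: cvgMl_tmp; exact: cgs].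
  - move=> x xab; have xab' : x \in `[a, b] by exact: subset_itv_oo_cc.
    by split; [exact: dD dG2 n x xab'|exact: dD dG1 n x xab'].
have Dmean n x : x \in `[a, b] -> exists2 y, x <= y <= x + 2 * h n & D n x = g y.
  rewrite in_itv/= => /andP[ax xb]; have := h1 n => hn1.
  by apply: (second_difference_mean (h0 n) dG2 dG1); rewrite /lo /hi; lra.
have M0 : 0 <= M by apply: le_trans (gM 0).
pose u n x := D n x * cutoff n x.
have tu n : exists v w, [/\ twice_diff (u n) v w, u n a = 0, u n b = 0, v a = 0 & v b = 0].
  have [v [w [tc ca cb va vb]]] := cutoff_twice_diff n.
  do 2 eexists; split; first exact: twice_diffM (tD n) tc.
  - by rewrite /u ca mulr0.
  - by rewrite /u cb mulr0.
  - by rewrite /= ca va !mulr0 addr0.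
  - by rewrite /= cb vb !mulr0 addr0.
have cu n : {within `[a, b], continuous (u n)} by have [v [w [[]]]] := tu n.
have cgab : {within `[a, b], continuous g} by exact: within_continuousT.
have : dist2 g (u n) @[n --> \oo] --> (0 : R).
  apply: (@Rintegral_dominated_cvg0 _ (cst (2 * M * (2 * M)))).
  - move=> n; have c1 := within_continuousB cgab (cu n).
    by have [] := square_int_continuous (within_continuousM c1 c1).
  - by apply: within_continuous_integrable; exact: within_continuous_cst.
  - move=> n x xab; have [y _ Dy] := Dmean n _ xab.
    have ugM : `|g x - u n x| <= 2 * M.
      rewrite (le_trans (ler_normB _ _))// mulr_natl mulr2n lerD// /u Dy normrM.
      rewrite -[M]mulr1 ler_pM// ger0_norm; have /andP[] := cutoff_le1 n xab => //.
    by rewrite normrM ler_pM.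
  move=> x xab; have xab' : x \in `[a, b] by exact: subset_itv_oo_cc.
  have Dg : D n x @[n --> \oo] --> g x.
    apply/cvgrPdist_lt => e e0.
    have /cvgrPdist_lt/(_ _ e0)[d /= d0 gd] := cg x.
    have : (2 * h n) @[n --> \oo] --> 2 * (0 : R).
      by apply: cvgMl_tmp; exact: cvg_harmonic.
    rewrite mulr0 => /cvgrPdist_lt/(_ _ d0); apply: filterS => n /=.
    rewrite sub0r normrN => hd; have [y /andP[xy yx] ->] := Dmean n _ xab'.
    apply: gd => /=; rewrite ler0_norm ?subr_le0// opprB ltrBlDr addrC.
    by apply: le_lt_trans yx _; rewrite ltrD2l (le_lt_trans (ler_norm _)).
  have ug : g x - u n x @[n --> \oo] --> g x - g x * 1.
    apply: cvgB; first exact: cvg_cst.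
    by apply: cvgM => //; exact: cutoff_cvg.
  rewrite [X in _ --> X](_ : _ = (g x - g x * 1) * (g x - g x * 1)); last by ring.
  exact: (cvgM ug ug).
move/cvgrPdist_lt => /(_ _ eps0)[n _ /(_ n (leqnn n))/=].
rewrite sub0r normrN => /(le_lt_trans (ler_norm _)) gu.
have [v [w [t ? ? ? ?]]] := tu n.
by exists (u n), v, w.
Qed.

Lemma square_int_smooth_dense f eps : square_int f -> 0 < eps ->
  exists u v w, [/\ twice_diff u v w, [/\ u a = 0, u b = 0, v a = 0 & v b = 0] &
    dist2 f u < eps].
Proof.
(* Two uses of [dist2_trans] give [2 (1 + 2 (1 + 1)) = 10] sixteenths of [eps]. *)
move=> sf eps0; have e8 : 0 < eps / 16 by rewrite divr_gt0.
have /cvgrPdist_lt/(_ _ e8)[n _ /(_ n (leqnn n))/=] := dist2_truncate sf.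
rewrite sub0r normrN => /(le_lt_trans (ler_norm _)).
set k := fun x => _ => fk.
(* [n.+1] in place of [n] provides the positive bound that [dist2_continuous_approx] asks for. *)
have kM x : `|k x| <= n.+1%:R.
  by apply: (@le_trans _ _ n%:R); [exact: clamp_le|rewrite ler_nat].
have mk : measurable_fun `[a, b] k.
  apply: measurableT_comp; last by have [] := sf.
  by apply: continuous_measurable_fun; exact: clamp_continuous.
have [g [cg gM kg]] := dist2_continuous_approx mk (ltr0Sn R n) (fun x _ => kM x) e8.
have [u [v [w [t uv gu]]]] := smooth_approx cg gM e8.
exists u, v, w; split => //.
have sk := square_int_bounded mk (fun x _ => kM x).
have sg : square_int g by apply: square_int_continuous; exact: within_continuousT.
have su : square_int u by apply: square_int_continuous; have [] := t.
have := dist2_trans sf sk su; have := dist2_trans sk sg su; lra.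
Qed.

End SquareIntegrable.

(** * The real transmission problem *)

Section L2.
Context (R : realType).
Notation mu := (@lebesgue_measure R).

(** Functions on the whole line, not classes. Only their values on one piece of the problem will
    enter the form, which is therefore only semidefinite. *)
Definition L2 : lmodType R := LfunType mu (lee1n 2 : (1 <= 2%:R%:E)%E).

Lemma L2_integrable (f g : L2) (x y : R) :
  mu.-integrable `[x, y] (EFin \o (fun t => f t * g t)).
Proof.
apply: (@integrableS _ _ _ mu setT) => //.
by apply/Lfun1_integrable; apply: Lfun2_mul_Lfun1; exact: LfunP.
Qed.

Lemma restrict_Lfun2 (a b : R) (u : R -> R) : {within `[a, b], continuous u} ->
  u \_ `[a, b] \in Lfun mu 2%:E.
Proof.
move=> cu; rewrite inE; apply/andP; split; rewrite inE/=.
  apply/(measurable_restrictT _ _).1 => //.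
  by have /integrableP[/measurable_EFinP] := within_continuous_integrable cu.
rewrite /finite_norm unlock poweR_lty//.
have /integrable_mkcond := within_continuous_integrable (within_continuousM cu cu).
move=> /(_ (measurable_itv _))/(integrable_lty measurableT); apply: le_lt_trans.
rewrite le_eqVlt; apply/orP; left; apply/eqP; apply: eq_integral => x _; rewrite -restrict_EFin /patch /=.
case: ifPn => _; last by rewrite (_ : point = 0%E)// abse0 poweR0r// pnatr_eq0.
by rewrite abse_EFin poweR_EFin powR_mulrn// -normrX ger0_norm ?sqr_ge0// expr2.
Qed.

Lemma L2_extension (a b : R) (u : R -> R) : {within `[a, b], continuous u} ->
  exists f : L2, {in `[a, b], f =1 u}.
Proof.
move=> cu; exists (Lfun_Sub _ (restrict_Lfun2 cu)) => x xab.
by rewrite /= patchE mem_set.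
Qed.

End L2.

(** * Continuous functions and solutions that vanish on an interval *)

Section Vanishing.
Context (R : realType).
Notation mu := (@lebesgue_measure R).
Context (a b : R) (ab : a < b).

Lemma near_eq_derive_eq (f g : R -> R) (x d e : R) : (\near x, f x = g x) ->
  is_derive x (1 : R) f d -> is_derive x (1 : R) g e -> d = e.
Proof. by move=> /near_eq_is_derive fg /fg[_ <-] [_ <-]. Qed.

Lemma within_continuous_eq0 (f : R -> R) : {within `[a, b], continuous f} ->
  {in `]a, b[, forall x, f x = 0} -> {in `[a, b], forall x, f x = 0}.
Proof.
move=> cf f0 x; rewrite in_itv/= => /andP[].
have [_ fa fb] := (continuous_within_itvP f ab).1 cf.
rewrite le_eqVlt => /predU1P[<- _|ax].
  apply: (@cvg_unique _ _ (f @ a^'+)) => //.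
  apply: cvg_near_cst; near=> y; apply: f0; rewrite in_itv/=; apply/andP; split.
    by near: y; exact: nbhs_right_gt.
  by near: y; exact: nbhs_right_lt.
rewrite le_eqVlt => /predU1P[->|xb]; last by apply: f0; rewrite in_itv/= ax xb.
apply: (@cvg_unique _ _ (f @ b^'-)) => //.
apply: cvg_near_cst; near=> y; apply: f0; rewrite in_itv/=; apply/andP; split.
  by near: y; exact: nbhs_left_gt.
by near: y; exact: nbhs_left_lt.
Unshelve. all: by end_near. Qed.

(** The primitive of [f^2] is monotone and vanishes at both ends, so it is constant and its
    derivative [f^2] is zero. *)
Lemma Rintegral_sqr_eq0 (f : R -> R) : {within `[a, b], continuous f} ->
  \int[mu]_(x in `[a, b]) (f x * f x) = 0 -> {in `[a, b], forall x, f x = 0}.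
Proof.
move=> cf I0; apply: within_continuous_eq0 => // x xab.
have cff := within_continuousM cf cf.
pose J := primitive a (fun x => f x * f x).
have cJ : {within `[a, b], continuous J} by exact: primitive_continuous (ltW ab) cff.
have dJ := primitive_derive cff.
have J0 : {in `[a, b], forall y, J y = 0}.
  move=> y yab; have yab' := yab; rewrite in_itv/= in yab; have [ay yb] := andP yab.
  have Ja : J a = 0 by exact: primitive_id.
  have Jy : 0 <= J y by apply: Rintegral_ge0 => t _; rewrite -expr2 sqr_ge0.
  apply/eqP; rewrite eq_le Jy andbT -I0 -[X in _ <= X]/(J b).
  apply: (@ger0_derive1_le_cc _ J a b) => //.
  - by move=> t /dJ[].
  - by move=> t /dJ[_]; rewrite derive1E => ->; rewrite -expr2 sqr_ge0.
  - by rewrite in_itv/= lexx ltW.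
have : f x * f x = 0.
  apply: (@near_eq_derive_eq J (cst 0) x) (dJ _ xab) (is_derive_cst _ _ _).
  have := near_in_itvoo xab; apply: filterS => y yab.
  by rewrite J0//; exact: subset_itv_oo_cc.
by move/eqP; rewrite mulf_eq0 orbb => /eqP.
Qed.

Lemma ode_eq0 q u v h : ode a b q u v h -> {in `[a, b], forall x, u x = 0} ->
  {in `[a, b], forall x, v x = 0}.
Proof.
move=> [_ cv _ d] u0; apply: within_continuous_eq0 => // x xab.
have [du _] := d _ xab.
apply: (@near_eq_derive_eq u (cst 0) x) du (is_derive_cst _ _ _).
have := near_in_itvoo xab; apply: filterS => y yab.
by rewrite u0//; exact: subset_itv_oo_cc.
Qed.

End Vanishing.

(** * The operator of the transmission problem on the two pieces *)

Section Concrete.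
Context (R : realType).
Notation mu := (@lebesgue_measure R).
Notation L2 := (L2 R).
Context (a c b : R) (ac : a < c) (cb : c < b) (q1 q2 : R -> R).
Hypothesis cq1 : {within `[a, c], continuous q1}.
Hypothesis cq2 : {within `[c, b], continuous q2}.
Context (alpha1 alpha2 beta1 beta2 beta1' beta2' gamma1 gamma2 delta1 delta2 : R).
Hypothesis alpha0 : 0 < alpha1 ^+ 2 + alpha2 ^+ 2.
Hypothesis gamma0 : 0 < gamma1 * gamma2.
Hypothesis delta0 : 0 < delta1 * delta2.
Let rho := beta1' * beta2 - beta1 * beta2'.
Hypothesis rho0 : 0 < rho.

(** The pieces are separate functions, so each has its own value at the interface. *)
Definition space : lmodType R := (L2 * L2 * R^o)%type.

Lemma space_lin1 k (U W : space) x : (k *: U + W).1.1 x = k * U.1.1 x + W.1.1 x.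
Proof. by rewrite (_ : (k *: U + W).1.1 = k *: U.1.1 + W.1.1). Qed.

Lemma space_lin2 k (U W : space) x : (k *: U + W).1.2 x = k * U.1.2 x + W.1.2 x.
Proof. by rewrite (_ : (k *: U + W).1.2 = k *: U.1.2 + W.1.2). Qed.

Lemma space_lin3 k (U W : space) : (k *: U + W).2 = k * U.2 + W.2.
Proof. by []. Qed.

Definition space_linE := (space_lin1, space_lin2, space_lin3).

Lemma space_scale1 k (U : space) x : (k *: U).1.1 x = k * U.1.1 x.
Proof. by rewrite (_ : (k *: U).1.1 = k *: U.1.1). Qed.

Lemma space_scale2 k (U : space) x : (k *: U).1.2 x = k * U.1.2 x.
Proof. by rewrite (_ : (k *: U).1.2 = k *: U.1.2). Qed.

Lemma space_scale3 k (U : space) : (k *: U).2 = k * U.2.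
Proof. by []. Qed.

Lemma space_addZ1 k (H U : space) x : (H + k *: U).1.1 x = H.1.1 x + k * U.1.1 x.
Proof. by rewrite addrC space_lin1 addrC. Qed.

Lemma space_addZ2 k (H U : space) x : (H + k *: U).1.2 x = H.1.2 x + k * U.1.2 x.
Proof. by rewrite addrC space_lin2 addrC. Qed.

Lemma space_addZ3 k (H U : space) : (H + k *: U).2 = H.2 + k * U.2.
Proof. by rewrite addrC space_lin3 addrC. Qed.

Definition space_addZE := (space_addZ1, space_addZ2, space_addZ3).

Definition ip (F G : space) : R :=
  gamma1 * gamma2 * (\int[mu]_(x in `[a, c]) (F.1.1 x * G.1.1 x)) +
  delta1 * delta2 * (\int[mu]_(x in `[c, b]) (F.1.2 x * G.1.2 x)) +
  delta1 * delta2 / rho * (F.2 * G.2).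

Lemma ipC F G : ip F G = ip G F.
Proof.
rewrite /ip; congr (_ * _ + _ * _ + _ * _); last by rewrite mulrC.
  by apply: eq_Rintegral => x _; rewrite mulrC.
by apply: eq_Rintegral => x _; rewrite mulrC.
Qed.

Lemma L2_int_lin (x y k : R) (f g h : L2) :
  \int[mu]_(t in `[x, y]) ((k *: f + g : L2) t * h t) =
  k * \int[mu]_(t in `[x, y]) (f t * h t) + \int[mu]_(t in `[x, y]) (g t * h t).
Proof.
have If := L2_integrable f h x y; have Ig := L2_integrable g h x y.
rewrite -RintegralZl// -RintegralD//; last first.
  by apply: eq_integrable (integrableZl _ k If) => // t _; rewrite /= EFinM.
by apply: eq_Rintegral => t _; rewrite mulrA -mulrDl.
Qed.

Lemma ipDZl (k : R) (F G H : space) : ip (k *: F + G) H = k * ip F H + ip G H.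
Proof.
rewrite /ip.
rewrite (_ : (k *: F + G).1.1 = k *: F.1.1 + G.1.1)//.
rewrite (_ : (k *: F + G).1.2 = k *: F.1.2 + G.1.2)//.
rewrite (_ : (k *: F + G).2 = k *: F.2 + G.2)//.
by rewrite !L2_int_lin//= /GRing.scale/=; ring.
Qed.

Lemma ip_ge0 F : 0 <= ip F F.
Proof.
apply: addr_ge0; first apply: addr_ge0.
- apply: mulr_ge0; first exact: ltW.
  by apply: Rintegral_ge0 => x _; rewrite -expr2 sqr_ge0.
- apply: mulr_ge0; first exact: ltW.
  by apply: Rintegral_ge0 => x _; rewrite -expr2 sqr_ge0.
- apply: mulr_ge0; first by rewrite divr_ge0// ltW.
  by rewrite -expr2 sqr_ge0.
Qed.

(* Solutions of the inhomogeneous equation [- u'' + (q - z) u = h] on both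
   pieces, with [u_i' = v_i], satisfying the transmission conditions. *)
Definition tsol (z : R) (u1 v1 u2 v2 h1 h2 : R -> R) : Prop :=
  [/\ ode a c (fun x => q1 x - z) u1 v1 h1, ode c b (fun x => q2 x - z) u2 v2 h2,
      gamma1 * u1 c = delta1 * u2 c & gamma2 * v1 c = delta2 * v2 c].

Lemma tsol_lin z k u1 v1 u2 v2 h1 h2 w1 z1 w2 z2 g1 g2 :
  tsol z u1 v1 u2 v2 h1 h2 -> tsol z w1 z1 w2 z2 g1 g2 ->
  tsol z (fun x => k * u1 x + w1 x) (fun x => k * v1 x + z1 x)
    (fun x => k * u2 x + w2 x) (fun x => k * v2 x + z2 x)
    (fun x => k * h1 x + g1 x) (fun x => k * h2 x + g2 x).
Proof.
move=> [s1 s2 t1 t2] [p1 p2 t3 t4]; split; [exact: ode_lin|exact: ode_lin| |].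
  by rewrite !mulrDr ![_ * (k * _)]mulrCA t1 t3.
by rewrite !mulrDr ![_ * (k * _)]mulrCA t2 t4.
Qed.

Lemma tsol_eq z u1 v1 u2 v2 h1 h2 w1 z1 w2 z2 g1 g2 :
  {in `[a, c], u1 =1 w1} -> {in `[a, c], v1 =1 z1} ->
  {in `[c, b], u2 =1 w2} -> {in `[c, b], v2 =1 z2} ->
  {in `[a, c], h1 =1 g1} -> {in `[c, b], h2 =1 g2} ->
  tsol z u1 v1 u2 v2 h1 h2 -> tsol z w1 z1 w2 z2 g1 g2.
Proof.
move=> e1 e2 e3 e4 e5 e6 [s1 s2 t1 t2].
have c1 : c \in `[a, c] by rewrite in_itv/= lexx ltW.
have c2 : c \in `[c, b] by rewrite in_itv/= lexx ltW.
split; [exact: ode_eq s1|exact: ode_eq s2| |]; first by rewrite -e1// -e3.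
by rewrite -e2// -e4.
Qed.

Lemma tsol_shift z k u1 v1 u2 v2 h1 h2 :
  tsol z u1 v1 u2 v2 (fun x => h1 x + k * u1 x) (fun x => h2 x + k * u2 x) ->
  tsol (z + k) u1 v1 u2 v2 h1 h2.
Proof.
have opE (q : R -> R) : (fun x => q x - (z + k)) = (fun x => q x - z - k).
  by apply/funext => x; rewrite opprD addrA.
move=> [/(@ode_shift _ _ _ _ k) s1 /(@ode_shift _ _ _ _ k) s2 t1 t2].
split => //; rewrite opE; [apply: ode_eq s1|apply: ode_eq s2] => // x _.
  by rewrite addrK.
by rewrite addrK.
Qed.

Let delta1_n0 : delta1 != 0.
Proof. by apply/eqP => d0; move: delta0; rewrite d0 mul0r ltxx. Qed.

Let delta2_n0 : delta2 != 0.
Proof. by apply/eqP => d0; move: delta0; rewrite d0 mulr0 ltxx. Qed.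

Lemma shifted_continuous (A : set R) (q : R -> R) z : {within A, continuous q} ->
  {within A, continuous (fun x => q x - z)}.
Proof. by move=> cq; apply: within_continuousB => //; exact: within_continuous_cst. Qed.

Lemma tsol_exists z A B h1 h2 : {within `[a, c], continuous h1} ->
  {within `[c, b], continuous h2} ->
  exists u1 v1 u2 v2, [/\ tsol z u1 v1 u2 v2 h1 h2, u1 a = A & v1 a = B].
Proof.
move=> ch1 ch2.
have [u1 [v1 [s1 uA vB]]] := ode_exists ac A B (shifted_continuous (z := z) cq1) ch1.
have [u2 [v2 [s2 uC vC]]] := ode_exists cb (gamma1 / delta1 * u1 c)
  (gamma2 / delta2 * v1 c) (shifted_continuous (z := z) cq2) ch2.
exists u1, v1, u2, v2; split => //; split => //.
- by rewrite uC mulrA mulrCA divff ?mulr1// delta1_n0.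
- by rewrite vC mulrA mulrCA divff ?mulr1// delta2_n0.
Qed.

(** Gronwall's inequality on the left piece, transfer through the transmission conditions, then
    Gronwall's inequality on the right piece. *)
Lemma tsol_bound z : exists2 C, 0 < C & forall u1 v1 u2 v2 h1 h2,
  tsol z u1 v1 u2 v2 h1 h2 -> let N := u1 a ^+ 2 + v1 a ^+ 2 +
      \int[mu]_(t in `[a, c]) (h1 t * h1 t) + \int[mu]_(t in `[c, b]) (h2 t * h2 t) in
   {in `[a, c], forall x, u1 x ^+ 2 + v1 x ^+ 2 <= C * N} /\
   {in `[c, b], forall x, u2 x ^+ 2 + v2 x ^+ 2 <= C * N}.
Proof.
have [C1 C10 H1] := ode_gronwall ac (shifted_continuous (z := z) cq1).
have [C2 C20 H2] := ode_gronwall cb (shifted_continuous (z := z) cq2).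
(* A bound for the factor by which [u^2 + v^2] grows across the interface. *)
pose k := (gamma1 / delta1) ^+ 2 + (gamma2 / delta2) ^+ 2 + 1.
have k1 : (gamma1 / delta1) ^+ 2 <= k.
  by rewrite /k -addrA lerDl addr_ge0// sqr_ge0.
have k2 : (gamma2 / delta2) ^+ 2 <= k.
  by rewrite /k addrAC lerDr addr_ge0// sqr_ge0.
have k0 : 0 < k by rewrite /k ltr_wpDl// addr_ge0// sqr_ge0.
exists (C1 + C2 * (k * C1 + 1)).
  by rewrite addr_gt0// mulr_gt0// ltr_wpDl// ltW// mulr_gt0.
move=> u1 v1 u2 v2 h1 h2 [s1 s2 t1 t2].
set I1 := (\int[mu]_(t in `[a, c]) _); set I2 := (\int[mu]_(t in `[c, b]) _) => N.
have I10 : 0 <= I1 by apply: Rintegral_ge0 => x _; rewrite -expr2 sqr_ge0.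
have I20 : 0 <= I2 by apply: Rintegral_ge0 => x _; rewrite -expr2 sqr_ge0.
have A0 : 0 <= u1 a ^+ 2 + v1 a ^+ 2 by rewrite addr_ge0// sqr_ge0.
have N0 : 0 <= N by rewrite /N !addr_ge0 ?sqr_ge0.
have b1 : {in `[a, c], forall x, u1 x ^+ 2 + v1 x ^+ 2 <= C1 * N}.
  move=> x xac; apply: le_trans (H1 _ _ _ s1 _ xac) _.
  by rewrite ler_pM2l// /N -/I1; lra.
have Ck : 0 <= C2 * (k * C1 + 1).
  by rewrite ltW// mulr_gt0// ltr_wpDl// ltW// mulr_gt0.
split => x xI.
  by apply: le_trans (b1 _ xI) _; rewrite ler_wpM2r// lerDl.
apply: le_trans (H2 _ _ _ s2 _ xI) _.
have c1 : c \in `[a, c] by rewrite in_itv/= lexx ltW.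
have u2c : u2 c ^+ 2 + v2 c ^+ 2 <= k * (C1 * N).
  have -> : u2 c = gamma1 / delta1 * u1 c.
    by rewrite mulrAC t1 mulrAC divff ?mul1r// delta1_n0.
  have -> : v2 c = gamma2 / delta2 * v1 c.
    by rewrite mulrAC t2 mulrAC divff ?mul1r// delta2_n0.
  apply: (@le_trans _ _ (k * (u1 c ^+ 2 + v1 c ^+ 2))); last by rewrite ler_pM2l// b1.
  by rewrite !exprMn mulrDr lerD// ler_wpM2r ?sqr_ge0// -?exprMn.
apply: (@le_trans _ _ (C2 * (k * C1 + 1) * N)).
  rewrite -mulrA ler_pM2l// -/I2 mulrDl mul1r -mulrA lerD// /N; lra.
by rewrite ler_wpM2r// lerDr ltW.
Qed.

Definition bform u v := beta1 * u - beta2 * v.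
Definition bform' u v := beta1' * u - beta2' * v.

(* [op_graph z U H] says that [U] is in the domain of the operator [A] of the
   problem and that [(A - z) U = H]. *)
Definition op_graph z (U H : space) : Prop := exists v1 v2 : R -> R,
  [/\ tsol z U.1.1 v1 U.1.2 v2 H.1.1 H.1.2,
      alpha1 * U.1.1 a + alpha2 * v1 a = 0,
      U.2 = bform' (U.1.2 b) (v2 b) &
      H.2 = - bform (U.1.2 b) (v2 b) - z * bform' (U.1.2 b) (v2 b)].

Lemma op_graph_lin z k U H W G : op_graph z U H -> op_graph z W G ->
  op_graph z (k *: U + W) (k *: H + G).
Proof.
move=> [v1 [v2 [t aU bU bH]]] [w1 [w2 [t' aW bW bG]]].
exists (fun x => k * v1 x + w1 x), (fun x => k * v2 x + w2 x); split.
- apply: tsol_eq (tsol_lin k t t') => x _; rewrite ?space_linE; reflexivity.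
- rewrite space_linE.
  by rewrite !mulrDr ![_ * (k * _)]mulrCA addrACA -mulrDr aU aW mulr0 addr0.
- by rewrite !space_linE bU bW /bform'; ring.
- by rewrite !space_linE bH bG /bform /bform'; ring.
Qed.

Lemma op_graph_shift z k U H : op_graph z U (H + k *: U) -> op_graph (z + k) U H.
Proof.
move=> [v1 [v2 [t aU bU bH]]]; exists v1, v2; split; [|exact: aU|exact: bU|].
  apply: tsol_shift; apply: tsol_eq t => x _; rewrite ?space_addZE; reflexivity.
by move: bH; rewrite space_addZE bU; lra.
Qed.

(** Both pairs are orthogonal to the nonzero vector [(alpha1, alpha2)], hence parallel. *)
Lemma wronskian_left u v w x : alpha1 * u + alpha2 * v = 0 ->
  alpha1 * w + alpha2 * x = 0 -> u * x - v * w = 0.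
Proof.
move=> h1 h2; apply/eqP; rewrite -(mulrI_eq0 _ (lregP (lt0r_neq0 alpha0))).
apply/eqP; transitivity ((alpha1 * u + alpha2 * v) * (alpha1 * x - alpha2 * w)
  - (alpha1 * w + alpha2 * x) * (alpha1 * v - alpha2 * u)); first by ring.
by rewrite h1 h2 !mul0r subrr.
Qed.

Lemma op_graph_sym U H W G : op_graph 0 U H -> op_graph 0 W G -> ip H W = ip U G.
Proof.
move=> [v1 [v2 [[s1 s2 t1 t2] aU bU bH]]] [w1 [w2 [[p1 p2 r1 r2] aW bW bG]]].
have := ode_lagrange ac s1 p1; have := ode_lagrange cb s2 p2.
rewrite (wronskian_left aU aW) subr0 => L2 L1.
(* The weights of the form are exactly those that make the boundary terms on both sides of [c]
   equal. *)
have tc : gamma1 * gamma2 * (U.1.1 c * w1 c - v1 c * W.1.1 c) =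
   delta1 * delta2 * (U.1.2 c * w2 c - v2 c * W.1.2 c).
  transitivity ((gamma1 * U.1.1 c) * (gamma2 * w1 c) -
    (gamma2 * v1 c) * (gamma1 * W.1.1 c)); first by ring.
  by rewrite t1 t2 r1 r2; ring.
apply/eqP; rewrite -subr_eq0; apply/eqP; rewrite /ip.
transitivity (gamma1 * gamma2 *
   (\int[mu]_(x in `[a, c]) (H.1.1 x * W.1.1 x) -
    \int[mu]_(x in `[a, c]) (U.1.1 x * G.1.1 x)) + delta1 * delta2 *
   (\int[mu]_(x in `[c, b]) (H.1.2 x * W.1.2 x) -
    \int[mu]_(x in `[c, b]) (U.1.2 x * G.1.2 x)) +
   delta1 * delta2 / rho * (H.2 * W.2 - U.2 * G.2)).
  by ring.
(* What remains at [b] cancels by the determinant identity [bform' U * bform W - bform U * bform' W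
   = - rho * (u w' - u' w)], which explains the weight [1 / rho] of the second component. *)
rewrite L1 L2 tc bH bG bU bW /bform /bform' !mul0r !subr0.
by rewrite /rho; field; rewrite gt_eqF.
Qed.

Definition continuous_element (F : space) : Prop :=
  {within `[a, c], continuous (F.1.1 : R -> R)} /\
  {within `[c, b], continuous (F.1.2 : R -> R)}.

Lemma op_graph_continuous z U H : op_graph z U H ->
  continuous_element U /\ continuous_element H.
Proof. by move=> [v1 [v2 [[[? ? ? ?] [? ? ? ?] ? ?] ? ? ?]]]. Qed.

Lemma space_extension (u1 u2 : R -> R) (r : R) : {within `[a, c], continuous u1} ->
  {within `[c, b], continuous u2} -> exists F : space,
  [/\ {in `[a, c], u1 =1 F.1.1}, {in `[c, b], u2 =1 F.1.2} & F.2 = r].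
Proof.
move=> /L2_extension[f1 f1P] /L2_extension[f2 f2P].
by exists (f1, f2, r); split => // x xI /=; rewrite (f1P, f2P).
Qed.

(* The function [phi(., z)] of the problem, on the two pieces. *)
Definition fundamental z u1 v1 u2 v2 : Prop :=
  [/\ tsol z u1 v1 u2 v2 (fun=> 0) (fun=> 0), u1 a = alpha2 & v1 a = - alpha1].

(** Minus the left-hand side of the boundary condition at [b]; at the end values of the fundamental
    solution it is, up to sign, the characteristic function of the problem. *)
Definition char_form z u v := - bform u v - z * bform' u v.

Lemma fundamental_exists z : exists u1 v1 u2 v2, fundamental z u1 v1 u2 v2.
Proof.
by apply: tsol_exists; exact: within_continuous_cst.
Qed.

Lemma fundamental_op_graph z u1 v1 u2 v2 (F : space) : fundamental z u1 v1 u2 v2 ->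
  char_form z (u2 b) (v2 b) = 0 ->
  {in `[a, c], u1 =1 F.1.1} -> {in `[c, b], u2 =1 F.1.2} ->
  F.2 = bform' (u2 b) (v2 b) -> op_graph z F 0.
Proof.
move=> [t ua va] cf e1 e2 F2; exists v1, v2.
have b2 : b \in `[c, b] by rewrite in_itv/= lexx ltW.
have a1 : a \in `[a, c] by rewrite in_itv/= lexx ltW.
split; [exact: (tsol_eq e1 _ e2 _ _ _ t)| | |].
- by rewrite -e1// ua va; ring.
- by rewrite -e2.
- by rewrite -e2.
Qed.

(** Every multiple of the fundamental solution respects the condition at [a]; adding [k] times it to
    a solution with zero initial values meets the condition at [b]. *)
Lemma op_graph_solve z u1 v1 u2 v2 H : fundamental z u1 v1 u2 v2 ->
  char_form z (u2 b) (v2 b) != 0 -> continuous_element H ->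
  exists U, op_graph z U H.
Proof.
move=> [t ua va] cf [cH1 cH2].
have [w1 [x1 [w2 [x2 [s wa xa]]]]] := tsol_exists z 0 0 cH1 cH2.
pose k := (H.2 - char_form z (w2 b) (x2 b)) / char_form z (u2 b) (v2 b).
have tw := tsol_lin k t s.
have [[c1 _ _ _] [c2 _ _ _] _ _] := tw.
have [F [e1 e2 F2]] := space_extension
  (bform' (k * u2 b + w2 b) (k * v2 b + x2 b)) c1 c2.
have b2 : b \in `[c, b] by rewrite in_itv/= lexx ltW.
have a1 : a \in `[a, c] by rewrite in_itv/= lexx ltW.
exists F, (fun x => k * v1 x + x1 x), (fun x => k * v2 x + x2 x); split.
- by apply: tsol_eq tw => // x _; rewrite mulr0 add0r.
- by rewrite -e1// ua va wa xa; ring.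
- by rewrite -e2.
- rewrite -e2// -/(char_form z _ _).
  transitivity (k * char_form z (u2 b) (v2 b) + char_form z (w2 b) (x2 b)).
    by rewrite /k divfK// subrK.
  by rewrite /char_form /bform /bform'; ring.
Qed.

Lemma sqr_form_le (m n u v : R) :
  (m * u - n * v) ^+ 2 <= (m ^+ 2 + n ^+ 2) * (u ^+ 2 + v ^+ 2).
Proof.
rewrite -subr_ge0 (_ : _ - _ = (m * v + n * u) ^+ 2) ?sqr_ge0//; ring.
Qed.

Lemma Rintegral_sqr_ge0 (f : R -> R) x y : 0 <= \int[mu]_(t in `[x, y]) (f t * f t).
Proof. by apply: Rintegral_ge0 => t _; rewrite -expr2 sqr_ge0. Qed.

Lemma ip_ge_pieces (F : space) :
  [/\ \int[mu]_(x in `[a, c]) (F.1.1 x * F.1.1 x) <= (gamma1 * gamma2)^-1 * ip F F,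
      \int[mu]_(x in `[c, b]) (F.1.2 x * F.1.2 x) <= (delta1 * delta2)^-1 * ip F F &
      F.2 ^+ 2 <= (delta1 * delta2 / rho)^-1 * ip F F].
Proof.
have dr : 0 < delta1 * delta2 / rho by rewrite divr_gt0.
have := mulr_ge0 (ltW gamma0) (Rintegral_sqr_ge0 F.1.1 a c).
have := mulr_ge0 (ltW delta0) (Rintegral_sqr_ge0 F.1.2 c b).
have := mulr_ge0 (ltW dr) (sqr_ge0 F.2).
by rewrite /ip -expr2 => i1 i2 i3; split; rewrite ler_pdivlMl//; lra.
Qed.

Lemma Rintegral_sqr_le (f : L2) x y B : x < y ->
  {in `[x, y], forall t, f t ^+ 2 <= B} ->
  \int[mu]_(t in `[x, y]) (f t * f t) <= B * (y - x).
Proof.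
move=> xy fB.
have -> : B * (y - x) = \int[mu]_(t in `[x, y]) B.
  by rewrite Rintegral_cst//= lebesgue_measure_itv/= lte_fin xy.
apply: le_Rintegral => //; first exact: L2_integrable.
  by apply: within_continuous_integrable; exact: within_continuous_cst.
Qed.

Lemma ip_le_sup (F : space) B w x :
  {in `[a, c], forall t, F.1.1 t ^+ 2 <= B} ->
  {in `[c, b], forall t, F.1.2 t ^+ 2 <= B} ->
  F.2 = bform' w x -> w ^+ 2 + x ^+ 2 <= B ->
  ip F F <= (gamma1 * gamma2 * (c - a) + delta1 * delta2 * (b - c) +
    delta1 * delta2 / rho * (beta1' ^+ 2 + beta2' ^+ 2)) * B.
Proof.
move=> /(Rintegral_sqr_le ac) i1 /(Rintegral_sqr_le cb) i2 F2 wxB.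
rewrite [leRHS](_ : _ = gamma1 * gamma2 * (B * (c - a)) +
  delta1 * delta2 * (B * (b - c)) +
  delta1 * delta2 / rho * ((beta1' ^+ 2 + beta2' ^+ 2) * B)); last by ring.
rewrite /ip; apply: lerD; first by apply: lerD; rewrite ler_pM2l.
rewrite ler_pM2l ?divr_gt0// F2 -expr2 (le_trans (sqr_form_le _ _ _ _))//.
by rewrite ler_wpM2l// addr_ge0// sqr_ge0.
Qed.

Definition fundamental_element (u1 u2 v2 : R -> R) (F : space) : Prop :=
  [/\ {in `[a, c], u1 =1 F.1.1}, {in `[c, b], u2 =1 F.1.2} &
     F.2 = bform' (u2 b) (v2 b)].

Lemma fundamental_element_exists z u1 v1 u2 v2 : fundamental z u1 v1 u2 v2 ->
  exists F, fundamental_element u1 u2 v2 F.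
Proof. by move=> [[[cu1 _ _ _] [cu2 _ _ _] _ _] _ _]; exact: space_extension. Qed.

(* Subtracting the multiple of the fundamental solution with the same initial
   values leaves a function controlled by the right-hand side. *)
Lemma op_graph_reduce z u1 v1 u2 v2 F : fundamental z u1 v1 u2 v2 ->
  fundamental_element u1 u2 v2 F ->
  exists2 C : R, 0 < C & forall U H, op_graph z U H -> exists t w x,
    [/\ ip (U - t *: F) (U - t *: F) <= C * ip H H,
        w ^+ 2 + x ^+ 2 <= C * ip H H &
        H.2 = t * char_form z (u2 b) (v2 b) + char_form z w x].
Proof.
move=> [tu ua va] [eF1 eF2 F2].
have [C C0 HC] := tsol_bound z.
(* [K1] bounds the integrals of the squares of the right-hand side by [ip H H]; [K2] turns a
   pointwise bound on the solution into one on [ip]. *)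
pose K1 := (gamma1 * gamma2)^-1 + (delta1 * delta2)^-1.
have K10 : 0 < K1 by rewrite addr_gt0// invr_gt0.
pose K2 := gamma1 * gamma2 * (c - a) + delta1 * delta2 * (b - c) +
    delta1 * delta2 / rho * (beta1' ^+ 2 + beta2' ^+ 2).
have K20 : 0 <= K2.
  rewrite /K2; apply: addr_ge0; first apply: addr_ge0.
  - by rewrite mulr_ge0 ?ltW// subr_gt0.
  - by rewrite mulr_ge0 ?ltW// subr_gt0.
  - by rewrite mulr_ge0 ?addr_ge0 ?sqr_ge0// divr_ge0// ltW.
have CK0 : 0 < C * K1 by exact: mulr_gt0.
have b2 : b \in `[c, b] by rewrite in_itv/= lexx ltW.
have a1 : a \in `[a, c] by rewrite in_itv/= lexx ltW.
exists (C * K1 * (K2 + 1)); first by rewrite mulr_gt0// ltr_wpDl.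
move=> U H [y1 [y2 [s aU bU bH]]].
(* By the condition at [a] the initial values of [U] are [t] times [(alpha2, - alpha1)], those of
   the fundamental solution. *)
pose t := (alpha2 * U.1.1 a - alpha1 * y1 a) / (alpha1 ^+ 2 + alpha2 ^+ 2).
have H0 := mulr_ge0 (ltW CK0) (ip_ge0 H).
have sw := tsol_lin (- t) tu s.
have ta1 : - t * u1 a + U.1.1 a = 0.
  rewrite ua /t; apply: (mulfI (lt0r_neq0 alpha0)); rewrite mulr0.
  transitivity (alpha1 * (alpha1 * U.1.1 a + alpha2 * y1 a)); last by rewrite aU mulr0.
  by field; rewrite lt0r_neq0.
have ta2 : - t * v1 a + y1 a = 0.
  rewrite va /t; apply: (mulfI (lt0r_neq0 alpha0)); rewrite mulr0.
  transitivity (alpha2 * (alpha1 * U.1.1 a + alpha2 * y1 a)); last by rewrite aU mulr0.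
  by field; rewrite lt0r_neq0.
have [] := HC _ _ _ _ _ _ sw; rewrite ta1 ta2 expr0n/= !add0r.
set B := C * _; have {}BE : B <= C * K1 * ip H H.
  rewrite -mulrA ler_pM2l//.
  under eq_Rintegral do rewrite mulr0 add0r.
  under [X in _ + X]eq_Rintegral do rewrite mulr0 add0r.
  by have [i1 i2 _] := ip_ge_pieces H; rewrite /K1 mulrDl lerD.
move=> B1 B2; exists t, (- t * u2 b + U.1.2 b), (- t * v2 b + y2 b); split.
- apply: (@le_trans _ _ (K2 * (C * K1 * ip H H))); last first.
    by rewrite -subr_ge0 (_ : _ - _ = C * K1 * ip H H)//; ring.
  apply: (ip_le_sup (w := - t * u2 b + U.1.2 b) (x := - t * v2 b + y2 b)).
  + move=> x xac; apply: le_trans BE; apply: le_trans (B1 _ xac).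
    by rewrite -scaleNr space_addZE -eF1// addrC lerDl sqr_ge0.
  + move=> x xcb; apply: le_trans BE; apply: le_trans (B2 _ xcb).
    by rewrite -scaleNr space_addZE -eF2// addrC lerDl sqr_ge0.
  + by rewrite -scaleNr space_addZE bU F2 /bform'; ring.
  + by apply: le_trans BE; exact: B2.
- apply: le_trans (B2 _ b2) _; apply: le_trans BE _.
  rewrite -subr_ge0 (_ : _ - _ = K2 * (C * K1 * ip H H)); first by rewrite mulr_ge0.
  by ring.
- by rewrite bH /char_form /bform /bform'; ring.
Qed.

(** If the characteristic form vanishes, [F] is an eigenvector orthogonal to [U], so [ip U U] is at
    most the square of [U - t *: F]. Otherwise the condition at [b] bounds [t]. *)
Lemma op_graph_apriori z : exists2 C : R, 0 < C & forall U H, op_graph z U H ->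
  (forall F, op_graph z F 0 -> ip U F = 0) -> ip U U <= C * ip H H.
Proof.
have [u1 [v1 [u2 [v2 fu]]]] := fundamental_exists z.
have [F fF] := fundamental_element_exists fu.
have [C C0 reduce] := op_graph_reduce fu fF.
have [cf0|cf0] := eqVneq (char_form z (u2 b) (v2 b)) 0.
  exists C => // U H gU UF; have [t [w [x [i1 i2 i3]]]] := reduce _ _ gU.
  have [eF1 eF2 F2] := fF.
  have {}UF := UF _ (fundamental_op_graph fu cf0 eF1 eF2 F2).
  have := mulr_ge0 (sqr_ge0 t) (ip_ge0 F).
  move: i1; rewrite !(ipE ipC ipDZl) (ipC F U) UF expr2; lra.
pose cf := char_form z (u2 b) (v2 b).
pose K3 := (beta1 + z * beta1') ^+ 2 + (beta2 + z * beta2') ^+ 2.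
have K30 : 0 <= K3 by rewrite addr_ge0// sqr_ge0.
(* Obtained from [t cf = H.2 - char_form z w x], where [K3] bounds the form; the factor 2 is that of
   the square of a difference. *)
pose K4 := 2 * ((delta1 * delta2 / rho)^-1 + K3 * C) / cf ^+ 2.
exists (2 * (C + K4 * ip F F)).
  rewrite mulr_gt0// ltr_pwDl// mulr_ge0 ?ip_ge0// /K4 divr_ge0 ?sqr_ge0//.
  rewrite mulr_ge0// addr_ge0//; last by rewrite mulr_ge0// ltW.
  by rewrite invr_ge0 divr_ge0// ltW.
move=> U H gU _; have [t [w [x [i1 i2 i3]]]] := reduce _ _ gU.
have [_ _ H2] := ip_ge_pieces H.
have cf2 : 0 < cf ^+ 2 by rewrite lt0r sqr_ge0 andbT expf_neq0.
have i4 : char_form z w x ^+ 2 <= K3 * (C * ip H H).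
  rewrite (_ : char_form z w x =
    - (beta1 + z * beta1') * w - (- (beta2 + z * beta2')) * x); last first.
    by rewrite /char_form /bform /bform'; ring.
  by rewrite (le_trans (sqr_form_le _ _ _ _))// !sqrrN ler_wpM2l.
have i5 : t ^+ 2 <= K4 * ip H H.
  rewrite /K4 mulrAC ler_pdivlMr// -exprMn -/cf.
  have -> : t * cf = H.2 - char_form z w x by rewrite i3 addrK.
  have := sqr_ge0 (H.2 + char_form z w x); move: H2 i4.
  set A := (_ / _)^-1 * _; rewrite (_ : 2 * _ * _ = 2 * A + 2 * (K3 * (C * ip H H))).
    rewrite !expr2; lra.
  by rewrite /A; ring.
have := ip_add_le ipC ipDZl ip_ge0 (U - t *: F) (t *: F).
rewrite subrK (ipZl ipDZl) (ipZr ipC ipDZl) => /le_trans; apply.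
have : t ^+ 2 * ip F F <= K4 * ip H H * ip F F by rewrite ler_wpM2r// ip_ge0.
by move: i1; rewrite expr2; lra.
Qed.

Lemma ip_null y N : ip N N = 0 -> ip y N = 0.
Proof.
move=> N0; have := ip_cauchy_schwarz ipC ipDZl ip_ge0 y N.
by rewrite N0 mulr0 => h; apply/eqP; rewrite -sqrf_eq0 eq_le h sqr_ge0.
Qed.

(** With right-hand side 0 the bounds of [op_graph_reduce] collapse: up to null vectors the kernel
    lies in the line of the fundamental element. *)
Lemma op_graph_reduce0 z u1 v1 u2 v2 F U : fundamental z u1 v1 u2 v2 ->
  fundamental_element u1 u2 v2 F -> op_graph z U 0 ->
  exists t, ip (U - t *: F) (U - t *: F) = 0 /\ t * char_form z (u2 b) (v2 b) = 0.
Proof.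
move=> fu fF gU; have [C C0 reduce] := op_graph_reduce fu fF.
have [t [w [x]]] := reduce _ _ gU; rewrite (ip0l ipDZl) mulr0 => -[i1 i2 i3].
have w0 : w = 0.
  by apply/eqP; rewrite -sqrf_eq0; have := sqr_ge0 w; have := sqr_ge0 x; lra.
have x0 : x = 0.
  by apply/eqP; rewrite -sqrf_eq0; have := sqr_ge0 w; have := sqr_ge0 x; lra.
exists t; split; first by apply/eqP; rewrite eq_le i1 ip_ge0.
move: i3; rewrite w0 x0 /char_form /bform /bform' (_ : (0 : space).2 = 0)//.
by lra.
Qed.

(** Eigenvalues are simple up to null vectors, so orthogonality to one eigenvector per eigenvalue is
    enough for [op_graph_apriori]. *)
Lemma op_graph_simple z F G y : op_graph z F 0 -> op_graph z G 0 ->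
  ip G G != 0 -> ip y G = 0 -> ip y F = 0.
Proof.
move=> gF gG G0 yG.
have [u1 [v1 [u2 [v2 fu]]]] := fundamental_exists z.
have [E fE] := fundamental_element_exists fu.
have [t [nF _]] := op_graph_reduce0 fu fE gF.
have [s [nG _]] := op_graph_reduce0 fu fE gG.
have yF : ip y F = t * ip y E.
  by have := ip_null y nF; rewrite !(ipE ipC ipDZl); lra.
have := ip_null y nG; have := ip_null G nG; rewrite !(ipE ipC ipDZl) yG yF.
have [->|s0] := eqVneq s 0; first by move/eqP: G0; lra.
move=> _ /eqP; rewrite sub0r oppr_eq0 mulf_eq0 (negbTE s0)/= => /eqP ->.
by rewrite mulr0.
Qed.

Lemma op_graph_char z u1 v1 u2 v2 U : fundamental z u1 v1 u2 v2 ->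
  op_graph z U 0 -> ip U U != 0 -> char_form z (u2 b) (v2 b) = 0.
Proof.
move=> fu gU U0; have [F fF] := fundamental_element_exists fu.
have [t [nU /eqP]] := op_graph_reduce0 fu fF gU.
rewrite mulf_eq0 => /orP[/eqP t0|/eqP//]; move: nU U0.
by rewrite t0 scale0r subr0 => ->; rewrite eqxx.
Qed.

Lemma ip_eq0_pieces (F : space) : continuous_element F -> ip F F = 0 ->
  {in `[a, c], forall x, F.1.1 x = 0} /\ {in `[c, b], forall x, F.1.2 x = 0}.
Proof.
move=> [c1 c2] F0; have [] := ip_ge_pieces F; rewrite F0 !mulr0 => i1 i2 _; split.
  by apply: Rintegral_sqr_eq0 => //; apply/eqP; rewrite eq_le i1 Rintegral_sqr_ge0.
by apply: Rintegral_sqr_eq0 => //; apply/eqP; rewrite eq_le i2 Rintegral_sqr_ge0.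
Qed.

(** A null element would vanish on the left piece, against the nonzero initial values
    [(alpha2, - alpha1)]. *)
Lemma fundamental_not_null z u1 v1 u2 v2 F : fundamental z u1 v1 u2 v2 ->
  fundamental_element u1 u2 v2 F -> ip F F != 0.
Proof.
move=> [[s1 s2 _ _] ua va] [eF1 eF2 _]; apply/eqP => F0.
have a1 : a \in `[a, c] by rewrite in_itv/= lexx ltW.
have cF : continuous_element F.
  have [cu1 _ _ _] := s1; have [cu2 _ _ _] := s2.
  split; [apply: subspace_eq_continuous cu1|apply: subspace_eq_continuous cu2];
    by move=> x; rewrite inE => /= xI; (exact: eF1 || exact: eF2).
have [F1 _] := ip_eq0_pieces cF F0.
have u10 : {in `[a, c], forall x, u1 x = 0} by move=> x xac; rewrite eF1// F1.
have := ode_eq0 ac s1 u10 a1; have := u10 _ a1; rewrite ua va => e2 /eqP.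
rewrite oppr_eq0 => /eqP e1; move: alpha0.
by rewrite e1 e2 expr0n/= addr0 ltxx.
Qed.

Lemma L2_square_int (f : L2) x y : square_int x y f.
Proof.
split; last exact: L2_integrable.
have mf : measurable_fun [set: measurableTypeR R] f by exact: measurable_funPT.
exact: measurable_funS mf.
Qed.

(** The smooth approximants vanish with their derivatives at [a], [c] and [b], so they satisfy every
    condition trivially, with second components 0. *)
Lemma op_graph_dense (F : space) eps : F.2 = 0 -> 0 < eps ->
  exists U H, op_graph 0 U H /\ ip (F - U) (F - U) < eps.
Proof.
move=> F2 eps0.
have e1 : 0 < eps / 2 / (gamma1 * gamma2) by rewrite !divr_gt0.
have e2 : 0 < eps / 2 / (delta1 * delta2) by rewrite !divr_gt0.
have [u1 [v1 [w1 [[cu1 cv1 cw1 d1] [ua uc va vc] i1]]]] :=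
  square_int_smooth_dense ac (L2_square_int F.1.1 a c) e1.
have [u2 [v2 [w2 [[cu2 cv2 cw2 d2] [uc' ub vc' vb] i2]]]] :=
  square_int_smooth_dense cb (L2_square_int F.1.2 c b) e2.
have [U [eU1 eU2 U2]] := space_extension 0 cu1 cu2.
have ch1 := within_continuousB (within_continuousM cq1 cu1) cw1.
have ch2 := within_continuousB (within_continuousM cq2 cu2) cw2.
have [H [eH1 eH2 H2]] := space_extension 0 ch1 ch2.
have a1 : a \in `[a, c] by rewrite in_itv/= lexx ltW.
have b2 : b \in `[c, b] by rewrite in_itv/= lexx ltW.
exists U, H; split.
  exists v1, v2; split.
  - have t : tsol 0 u1 v1 u2 v2 (fun x => q1 x * u1 x - w1 x)
        (fun x => q2 x * u2 x - w2 x).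
      split; [split => // x /d1[? ?]|split => // x /d2[? ?]| |].
      + by split => //; apply: is_derive_eq; rewrite subr0; ring.
      + by split => //; apply: is_derive_eq; rewrite subr0; ring.
      + by rewrite uc uc' !mulr0.
      + by rewrite vc vc' !mulr0.
    exact: (tsol_eq eU1 _ eU2 _ eH1 eH2 t).
  - by rewrite -eU1// ua va !mulr0 addr0.
  - by rewrite U2 -eU2// /bform' ub vb !mulr0 subrr.
  - by rewrite H2 -eU2// /bform' /bform ub vb !mulr0 !subrr oppr0 mulr0 subrr.
rewrite -[U]scale1r -scaleNr /ip space_addZE F2 U2 mulr0 addr0 mulr0 mulr0 addr0.
rewrite (_ : \int[mu]_(x in `[a, c]) _ = dist2 a c F.1.1 u1); last first.
  by apply: eq_Rintegral => x; rewrite inE => xI; rewrite space_addZE -eU1// mulN1r.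
rewrite (_ : \int[mu]_(x in `[c, b]) _ = dist2 c b F.1.2 u2); last first.
  by apply: eq_Rintegral => x; rewrite inE => xI; rewrite space_addZE -eU2// mulN1r.
move: i1 i2; rewrite !ltr_pdivlMr//; lra.
Qed.

Lemma op_graph_eigen z U : op_graph 0 U (z *: U) <-> op_graph z U 0.
Proof.
split=> gU; first by rewrite -[z]add0r; apply: op_graph_shift; rewrite add0r.
rewrite -(subrr z); apply: op_graph_shift.
by rewrite scaleNr subrr.
Qed.

Lemma op_graph_parseval (e : nat -> space) (l : nat -> R) :
  (forall n, op_graph (l n) (e n) 0) -> (forall n, ip (e n) (e n) = 1) ->
  injective l ->
  (forall z U, op_graph z U 0 -> ip U U != 0 -> exists n, l n = z) ->
  forall F : space, F.2 = 0 -> series (fun n => ip F (e n) ^+ 2) @ \oo --> ip F F.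
Proof.
move=> ge e1 l_inj l_all F F2.
have ge0 n : op_graph 0 (e n) (l n *: e n) by apply/op_graph_eigen.
have e_orth m n : ip (e m) (e n) = (m == n)%:R.
  have [->|mn] := eqVneq m n; first by rewrite e1.
  have := op_graph_sym (ge0 m) (ge0 n).
  rewrite (ipZl ipDZl) (ipZr ipC ipDZl) => /eqP.
  rewrite -subr_eq0 -mulrBl mulf_eq0 subr_eq0 => /orP[/eqP/l_inj lmn|/eqP//].
  by rewrite lmn eqxx in mn.
(* The eigenvalues form a countable set, while [[0, 1]] has positive measure. *)
have [nu lnu] : exists nu, forall n, l n != nu.
  apply: contrapT => /forallNP nu.
  have : (`[0, 1]%classic : set R) `<=` range l.
    move=> x _; have /existsNP[n /negP/negPn/eqP <-] := nu x.
    by exists n.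
  move=> /subset_card_le/card_le_trans/(_ (card_image_le l setT)).
  move=> /countable_lebesgue_measure0; rewrite lebesgue_measure_itv/= lte_fin ltr01.
  by move/eqP; rewrite oppr0 adde0 eqe oner_eq0.
apply: (@parseval_closure R space ip ipC ipDZl ip_ge0 (op_graph 0) continuous_element
  _ _ _ nu _ e l ge0 e_orth l_inj lnu) => //.
- exact: op_graph_lin.
- exact: op_graph_sym.
- exact: op_graph_continuous.
- move=> H cH.
  have [u1 [v1 [u2 [v2 fu]]]] := fundamental_exists nu.
  have [E fE] := fundamental_element_exists fu.
  (* If the characteristic form vanished at [nu], the fundamental element would be an eigenvector
     and [nu] one of the [l n]. *)
  have [|U gU] := op_graph_solve (H := H) fu _ cH.
    apply/eqP => cf0; have [eE1 eE2 E2] := fE.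
    have gE := fundamental_op_graph fu cf0 eE1 eE2 E2.
    have [n /eqP] := l_all _ _ gE (fundamental_not_null fu fE).
    by rewrite (negbTE (lnu n)).
  exists U; rewrite -(subrr nu); apply: op_graph_shift.
  by rewrite scaleNr addrK.
- move=> z; have [C C0 HC] := op_graph_apriori z; exists C => // y h gy ly.
  apply: HC; first by rewrite -[z]add0r; exact: op_graph_shift.
  move=> G gG; have [G0|G0] := eqVneq (ip G G) 0; first exact: ip_null.
  have [n ln] := l_all _ _ gG G0.
  apply: (op_graph_simple gG _ _ (ly n ln)); first by rewrite -ln.
  by rewrite e1 oner_neq0.
- move=> eps eps0; exact: op_graph_dense.
Qed.

End Concrete.

(** * From complex to real solutions *)

Section OneSided.
Context (R : realType).
Implicit Types (D : set R) (u U du f : R -> R) (x lo hi l : R).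

Lemma within_dnbhs_right D f x l : (\forall y \near x^'+, D y) ->
  f y @[y --> within D x^'] --> l -> f y @[y --> x^'+] --> l.
Proof.
move=> nD cf A /cf fA.
have {}nD : \forall y \near x, x < y -> D y by [].
have {}fA : \forall y \near x, y != x -> D y -> A (f y) by [].
suff : \forall y \near x, x < y -> A (f y) by [].
apply: filterS2 nD fA => y Dy fA xy.
by apply: fA; [rewrite gt_eqF|exact: Dy].
Qed.

Lemma within_dnbhs_left D f x l : (\forall y \near x^'-, D y) ->
  f y @[y --> within D x^'] --> l -> f y @[y --> x^'-] --> l.
Proof.
move=> nD cf A /cf fA.
have {}nD : \forall y \near x, y < x -> D y by [].
have {}fA : \forall y \near x, y != x -> D y -> A (f y) by [].
suff : \forall y \near x, y < x -> A (f y) by [].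
apply: filterS2 nD fA => y Dy fA xy.
by apply: fA; [rewrite lt_eqF|exact: Dy].
Qed.

Lemma within_nbhs_right D f x l : (\forall y \near x^'+, D y) ->
  f y @[y --> within D (nbhs x)] --> l -> f y @[y --> x^'+] --> l.
Proof.
move=> nD cf; apply: within_dnbhs_right nD _ => A /cf fA.
have {}fA : \forall y \near x, D y -> A (f y) by [].
suff : \forall y \near x, y != x -> D y -> A (f y) by [].
by apply: filterS fA => y fA _.
Qed.

Lemma within_nbhs_left D f x l : (\forall y \near x^'-, D y) ->
  f y @[y --> within D (nbhs x)] --> l -> f y @[y --> x^'-] --> l.
Proof.
move=> nD cf; apply: within_dnbhs_left nD _ => A /cf fA.
have {}fA : \forall y \near x, D y -> A (f y) by [].
suff : \forall y \near x, y != x -> D y -> A (f y) by [].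
by apply: filterS fA => y fA _.
Qed.

Lemma within_dnbhs_interior D f x l : (\forall y \near x, D y) ->
  f y @[y --> within D x^'] --> l -> f y @[y --> x^'] --> l.
Proof.
move=> nD cf A /cf fA.
have {}fA : \forall y \near x, y != x -> D y -> A (f y) by [].
suff : \forall y \near x, y != x -> A (f y) by [].
apply: filterS2 nD fA => y Dy fA xy.
by apply: fA; [exact: xy|exact: Dy].
Qed.

Lemma is_derive_dnbhs u x l :
  (u y - u x) / (y - x) @[y --> x^'] --> l -> is_derive x (1 : R) u l.
Proof.
move=> ul; apply/is_derive1_caratheodory.
exists (fun y => if y == x then l else (u y - u x) / (y - x)); split.
- move=> z; case: eqP => [->|/eqP zx]; first by rewrite !subrr mulr0.
  by rewrite divfK// subr_eq0.
- apply/continuous_withinNx; rewrite eqxx.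
  apply: cvg_trans ul; apply: near_eq_cvg; near=> y.
  by rewrite ifF//; apply/negbTE; near: y; exact: nbhs_dnbhs_neq.
- by rewrite eqxx.
Unshelve. all: by end_near. Qed.

Lemma quotient_continuous (F : set_system R) (FF : ProperFilter F) u x l :
  y @[y --> F] --> x -> (\forall y \near F, y != x) ->
  (u y - u x) / (y - x) @[y --> F] --> l -> u y @[y --> F] --> u x.
Proof.
move=> Fx Fneq ul.
have : (u y - u x) / (y - x) * (y - x) + u x @[y --> F] --> l * (x - x) + u x.
  apply: cvgD; last exact: cvg_cst.
  by apply: cvgM => //; apply: cvgB => //; exact: cvg_cst.
rewrite subrr mulr0 add0r; apply: cvg_trans; apply: near_eq_cvg.
apply: filterS Fneq => y yx.
by rewrite divfK ?subrK// subr_eq0.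
Qed.

(** At an end point in [D] continuity follows from the one-sided derivative; at the other, the
    interface, [U] takes the limit of [u] as its value. *)
Lemma extension_continuous lo hi D u du U : lo < hi ->
  `]lo, hi[ `<=` D -> (forall x, D x -> U x = u x) ->
  (forall x, D x -> (u y - u x) / (y - x) @[y --> within D x^'] --> du x) ->
  D lo \/ u y @[y --> lo^'+] --> U lo -> D hi \/ u y @[y --> hi^'-] --> U hi ->
  {within `[lo, hi], continuous U} /\
  {in `]lo, hi[, forall x : R, is_derive x (1 : R) U (du x)}.
Proof.
move=> lohi sD Uu dD Dlo Dhi.
have nlo : \forall y \near lo^'+, D y.
  near=> y; apply: sD; rewrite /= in_itv/=; apply/andP; split.
    by near: y; exact: nbhs_right_gt.
  by near: y; exact: nbhs_right_lt.
have nhi : \forall y \near hi^'-, D y.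
  near=> y; apply: sD; rewrite /= in_itv/=; apply/andP; split.
    by near: y; exact: nbhs_left_gt.
  by near: y; exact: nbhs_left_lt.
have dU : {in `]lo, hi[, forall x : R, is_derive x (1 : R) U (du x)}.
  move=> x xI; have nD : \forall y \near x, D y.
    by have := near_in_itvoo xI; apply: filterS => y yI; exact: sD.
  apply: (@near_eq_is_derive _ _ _ u).
    by apply: filterS nD => y /Uu ->.
  by apply: is_derive_dnbhs; apply: within_dnbhs_interior nD _; apply: dD; exact: sD.
split => //; apply/(continuous_within_itvP _ lohi); split.
- by move=> x /dU; exact: is_derive_continuous.
- have : u y @[y --> lo^'+] --> U lo.
    case: Dlo => // Dlo; rewrite Uu//.
    apply: (@quotient_continuous _ _ _ _ (du lo)).
    + exact/cvg_at_right_filter/cvg_id.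
    + near=> y; rewrite gt_eqF//; near: y; exact: nbhs_right_gt.
    + exact: within_dnbhs_right nlo (dD _ Dlo).
  apply: cvg_trans; apply: near_eq_cvg.
  by apply: filterS nlo => y /Uu.
- have : u y @[y --> hi^'-] --> U hi.
    case: Dhi => // Dhi; rewrite Uu//.
    apply: (@quotient_continuous _ _ _ _ (du hi)).
    + exact/cvg_at_left_filter/cvg_id.
    + near=> y; rewrite lt_eqF//; near: y; exact: nbhs_left_lt.
    + exact: within_dnbhs_left nhi (dD _ Dhi).
  apply: cvg_trans; apply: near_eq_cvg.
  by apply: filterS nhi => y /Uu.
Unshelve. all: by end_near. Qed.

End OneSided.

(** Used with [e] the interface and [l] a one-sided limit there, as the value of the function itself
    at that point carries no information. *)
Definition ext (R : realType) (e l : R) (u : R -> R) (x : R) : R :=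
  if x == e then l else u x.

Lemma ext_neq (R : realType) (e l : R) (u : R -> R) x : x != e -> ext e l u x = u x.
Proof. by rewrite /ext => /negbTE ->. Qed.

Lemma ext_id (R : realType) (e l : R) (u : R -> R) : ext e l u e = l.
Proof. by rewrite /ext eqxx. Qed.

(** * Real and imaginary parts of derivatives *)

Section Parts.
Context (R : realType).
Implicit Types (D : set R) (u du : R -> R[i]).

Lemma Re_quotient (z w : R[i]) (r : R) :
  complex.Re ((z - w) / r%:C) = (complex.Re z - complex.Re w) / r.
Proof.
rewrite -fmorphV/=; case: z w => [z1 z2] [w1 w2] /=.
by rewrite mulr0 subr0.
Qed.

Lemma Im_quotient (z w : R[i]) (r : R) :
  complex.Im ((z - w) / r%:C) = (complex.Im z - complex.Im w) / r.
Proof.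
rewrite -fmorphV/=; case: z w => [z1 z2] [w1 w2] /=.
by rewrite mulr0 add0r.
Qed.

Lemma cderiv_on_Re D u du : cderiv_on D u du -> forall x, D x ->
  (complex.Re (u y) - complex.Re (u x)) / (y - x) @[y --> within D x^'] --> complex.Re (du x).
Proof.
move=> d x Dx; have [+ _] := d x Dx.
by under eq_fun do rewrite Re_quotient.
Qed.

Lemma cderiv_on_Im D u du : cderiv_on D u du -> forall x, D x ->
  (complex.Im (u y) - complex.Im (u x)) / (y - x) @[y --> within D x^'] --> complex.Im (du x).
Proof.
move=> d x Dx; have [_ +] := d x Dx.
by under eq_fun do rewrite Im_quotient.
Qed.

End Parts.

(** * Integrals of complex functions that are real off one end point *)

Section Cintegral.
Context (R : realType).
Notation mu := (@lebesgue_measure R).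

Lemma eq_real_complex (z : R[i]) : complex.Im z = 0 -> z = (complex.Re z)%:C.
Proof. by case: z => x y /= ->. Qed.

Lemma cintegral_left (x y : R) (w : R -> R[i]) (g : R -> R) :
  mu.-integrable `[x, y] (EFin \o g) -> (forall t, `[x, y[%classic t -> w t = (g t)%:C) ->
  cintegral `[x, y] w = (\int[mu]_(t in `[x, y]) g t)%:C.
Proof.
move=> ig wg; have ig' : mu.-integrable `[x, y[ (EFin \o g).
  by apply: integrableS ig => //; apply: subset_itv; rewrite bnd_simp.
have part (p : R[i] -> R) (h : R -> R) : mu.-integrable `[x, y[ (EFin \o h) ->
    (forall t, `[x, y[%classic t -> p (w t) = h t) ->
    \int[mu]_(t in `[x, y]) p (w t) = \int[mu]_(t in `[x, y[) h t.
  move=> ih ph; rewrite -Rintegral_itv_bndo_bndc; last first.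
    by apply: eq_integrable ih => // t; rewrite inE => tI; rewrite /= ph.
  by apply: eq_Rintegral => t; rewrite inE => tI; exact: ph.
rewrite /cintegral (part _ g)//; last by move=> t tI; rewrite wg.
rewrite (part _ (cst 0))//; last by move=> t tI; rewrite wg.
  by rewrite Rintegral_cst// mul0r Rintegral_itv_bndo_bndc.
exact: integrable0.
Qed.

Lemma cintegral_right (x y : R) (w : R -> R[i]) (g : R -> R) :
  mu.-integrable `[x, y] (EFin \o g) -> (forall t, `]x, y]%classic t -> w t = (g t)%:C) ->
  cintegral `[x, y] w = (\int[mu]_(t in `[x, y]) g t)%:C.
Proof.
move=> ig wg; have ig' : mu.-integrable `]x, y] (EFin \o g).
  by apply: integrableS ig => //; apply: subset_itv; rewrite bnd_simp.
have part (p : R[i] -> R) (h : R -> R) : mu.-integrable `]x, y] (EFin \o h) ->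
    (forall t, `]x, y]%classic t -> p (w t) = h t) ->
    \int[mu]_(t in `[x, y]) p (w t) = \int[mu]_(t in `]x, y]) h t.
  move=> ih ph; rewrite -Rintegral_itv_obnd_cbnd; last first.
    by apply: eq_integrable ih => // t; rewrite inE => tI; rewrite /= ph.
  by apply: eq_Rintegral => t; rewrite inE => tI; exact: ph.
rewrite /cintegral (part _ g)//; last by move=> t tI; rewrite wg.
rewrite (part _ (cst 0))//; last by move=> t tI; rewrite wg.
  by rewrite Rintegral_cst// mul0r Rintegral_itv_obnd_cbnd.
exact: integrable0.
Qed.

End Cintegral.

(** * Complex solutions of the problem as elements of the real space *)

Section Problem.
Context (R : realType) (P : transmission_problem R).
Local Notation a := (left_end P).
Local Notation c := (interface P).
Local Notation b := (right_end P).
Local Notation ac := (left_end_lt_interface P).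
Local Notation cb := (interface_lt_right_end P).
Context (ql qr : R).
Hypothesis qlP : potential P x @[x --> c^'-] --> ql.
Hypothesis qrP : potential P x @[x --> c^'+] --> qr.
Let q1 := ext c ql (potential P).
Let q2 := ext c qr (potential P).

Lemma potential_left_continuous : {within `[a, c], continuous q1}.
Proof.
have sub : `]a, c[ `<=` `[a, c[ by apply: subset_itv; rewrite bnd_simp.
have cq := potential_continuous_left (t := P).
have nc : \forall y \near c^'-, y != c.
  near=> y; rewrite lt_eqF//; near: y; exact: nbhs_left_lt.
have na : \forall y \near a^'+, `[a, c[%classic y /\ y != c.
  near=> y; have ay : a < y by near: y; exact: nbhs_right_gt.
  have yc : y < c by near: y; apply: nbhs_right_lt; exact: ac.
  by rewrite /= in_itv/= ltW// yc lt_eqF.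
apply/(continuous_within_itvP _ ac); split.
- move=> x xI; have : {in `]a, c[%classic, continuous (potential P)}.
    rewrite -continuous_open_subspace//; exact: continuous_subspaceW cq.
  move=> /(_ x (mem_set xI)) cx.
  have nx : \forall y \near x, q1 y = potential P y.
    have := near_in_itvoo xI; apply: filterS => y; rewrite in_itv/= => /andP[_ yc].
    by rewrite /q1 ext_neq// lt_eqF.
  rewrite /prop_for /continuous_at (nbhs_singleton nx).
  by apply: cvg_trans cx; apply: near_eq_cvg; apply: filterS nx => y ->.
- rewrite /q1 ext_neq ?lt_eqF ?ac//.
  move/subspace_continuousP : cq => /(_ a); rewrite /= in_itv/= lexx ac => /(_ isT) ca.
  have : potential P y @[y --> a^'+] --> potential P a.
    by apply: within_nbhs_right ca; apply: filterS na => y [].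
  apply: cvg_trans; apply: near_eq_cvg; apply: filterS na => y [_ yc].
  by rewrite ext_neq.
- rewrite /q1 ext_id; apply: cvg_trans qlP; apply: near_eq_cvg.
  by apply: filterS nc => y yc; rewrite ext_neq.
Unshelve. all: by end_near. Qed.

Lemma potential_right_continuous : {within `[c, b], continuous q2}.
Proof.
have sub : `]c, b[ `<=` `]c, b] by apply: subset_itv; rewrite bnd_simp.
have cq := potential_continuous_right (t := P).
have nc : \forall y \near c^'+, y != c.
  near=> y; rewrite gt_eqF//; near: y; exact: nbhs_right_gt.
have na : \forall y \near b^'-, `]c, b]%classic y /\ y != c.
  near=> y; have yb : y < b by near: y; exact: nbhs_left_lt.
  have cy : c < y by near: y; apply: nbhs_left_gt; exact: cb.
  by rewrite /= in_itv/= (ltW yb) cy gt_eqF.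
apply/(continuous_within_itvP _ cb); split.
- move=> x xI; have : {in `]c, b[%classic, continuous (potential P)}.
    rewrite -continuous_open_subspace//; exact: continuous_subspaceW cq.
  move=> /(_ x (mem_set xI)) cx.
  have nx : \forall y \near x, q2 y = potential P y.
    have := near_in_itvoo xI; apply: filterS => y; rewrite in_itv/= => /andP[cy _].
    by rewrite /q2 ext_neq// gt_eqF.
  rewrite /prop_for /continuous_at (nbhs_singleton nx).
  by apply: cvg_trans cx; apply: near_eq_cvg; apply: filterS nx => y ->.
- rewrite /q2 ext_id; apply: cvg_trans qrP; apply: near_eq_cvg.
  by apply: filterS nc => y yc; rewrite ext_neq.
- rewrite /q2 ext_neq ?gt_eqF ?cb//.
  move/subspace_continuousP : cq => /(_ b); rewrite /= in_itv/= lexx cb => /(_ isT) ca.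
  have : potential P y @[y --> b^'-] --> potential P b.
    by apply: within_nbhs_left ca; apply: filterS na => y [].
  apply: cvg_trans; apply: near_eq_cvg; apply: filterS na => y [_ yc].
  by rewrite ext_neq.
Unshelve. all: by end_near. Qed.

(** For complex [lam] the two parts are coupled; the coupling is moved to the right-hand side, so
    that both satisfy the real equation with parameter 0. *)
Lemma solves_on_ode lo hi e D Q lam u du ul dul : lo < hi ->
  `]lo, hi[ `<=` D -> (forall x, D x -> x != e) ->
  D lo \/ [/\ lo = e, ccvg u lo^'+ ul & ccvg du lo^'+ dul] ->
  D hi \/ [/\ hi = e, ccvg u hi^'- ul & ccvg du hi^'- dul] ->
  {in `]lo, hi[, Q =1 potential P} -> solves_on P lam D u du ->
  let ur := ext e (complex.Re ul) (fun x => complex.Re (u x)) in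
  let ui := ext e (complex.Im ul) (fun x => complex.Im (u x)) in
  let vr := ext e (complex.Re dul) (fun x => complex.Re (du x)) in
  let vi := ext e (complex.Im dul) (fun x => complex.Im (du x)) in
  ode lo hi (fun x => Q x - 0) ur vr
    (fun x => complex.Re lam * ur x - complex.Im lam * ui x) /\
  ode lo hi (fun x => Q x - 0) ui vi
    (fun x => complex.Im lam * ur x + complex.Re lam * ui x).
Proof.
move=> lohi sD De Hlo Hhi Qq [d1 [ddu [d2 eqn]]] ur ui vr vi.
have [cur dur] : {within `[lo, hi], continuous ur} /\
    {in `]lo, hi[, forall x : R, is_derive x (1 : R) ur (complex.Re (du x))}.
  apply: (extension_continuous lohi sD _ (cderiv_on_Re d1)).
  - by move=> x /De xe; rewrite /ur ext_neq.
  - by case: Hlo => [|[loe [h _] _]]; [left|right; rewrite /ur {2}loe ext_id].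
  - by case: Hhi => [|[hie [h _] _]]; [left|right; rewrite /ur {2}hie ext_id].
have [cui dui] : {within `[lo, hi], continuous ui} /\
    {in `]lo, hi[, forall x : R, is_derive x (1 : R) ui (complex.Im (du x))}.
  apply: (extension_continuous lohi sD _ (cderiv_on_Im d1)).
  - by move=> x /De xe; rewrite /ui ext_neq.
  - by case: Hlo => [|[loe [_ h] _]]; [left|right; rewrite /ui {2}loe ext_id].
  - by case: Hhi => [|[hie [_ h] _]]; [left|right; rewrite /ui {2}hie ext_id].
have [cvr dvr] : {within `[lo, hi], continuous vr} /\
    {in `]lo, hi[, forall x : R, is_derive x (1 : R) vr (complex.Re (ddu x))}.
  apply: (extension_continuous lohi sD _ (cderiv_on_Re d2)).
  - by move=> x /De xe; rewrite /vr ext_neq.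
  - by case: Hlo => [|[loe _ [h _]]]; [left|right; rewrite /vr {2}loe ext_id].
  - by case: Hhi => [|[hie _ [h _]]]; [left|right; rewrite /vr {2}hie ext_id].
have [cvi dvi] : {within `[lo, hi], continuous vi} /\
    {in `]lo, hi[, forall x : R, is_derive x (1 : R) vi (complex.Im (ddu x))}.
  apply: (extension_continuous lohi sD _ (cderiv_on_Im d2)).
  - by move=> x /De xe; rewrite /vi ext_neq.
  - by case: Hlo => [|[loe _ [_ h]]]; [left|right; rewrite /vi {2}loe ext_id].
  - by case: Hhi => [|[hie _ [_ h]]]; [left|right; rewrite /vi {2}hie ext_id].
have cM k (f : R -> R) : {within `[lo, hi], continuous f} ->
    {within `[lo, hi], continuous (fun x => k * f x)}.
  by apply: within_continuousM; exact: within_continuous_cst.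
have eqnR x : x \in `]lo, hi[ -> complex.Re (ddu x) = (Q x - 0) * ur x -
    (complex.Re lam * ur x - complex.Im lam * ui x) /\
   complex.Im (ddu x) = (Q x - 0) * ui x -
    (complex.Im lam * ur x + complex.Re lam * ui x).
  move=> xI; have Dx := sD _ xI; have xe := De _ Dx.
  rewrite /ur /ui !ext_neq// subr0 Qq//; have := eqn _ Dx.
  move: (ddu x) (u x) => [d d'] [w w']; case: (lam) => [l l'] /=.
  by move=> /eqP; rewrite eq_complex/= => /andP[/eqP h1 /eqP h2]; split; lra.
split; split => //.
- by apply: within_continuousB; exact: cM.
- move=> x xI; have xe := De _ (sD _ xI); rewrite -(eqnR x xI).1; split; last exact: dvr.
  by rewrite /vr ext_neq//; exact: dur.
- by apply: within_continuousD; exact: cM.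
- move=> x xI; have xe := De _ (sD _ xI); rewrite -(eqnR x xI).2; split; last exact: dvi.
  by rewrite /vi ext_neq//; exact: dui.
Qed.

Local Notation tsolP := (tsol a c b q1 q2 (gamma1 P) (gamma2 P) (delta1 P) (delta2 P)).
Local Notation fundamentalP := (fundamental a c b q1 q2 (alpha1 P) (alpha2 P)
  (gamma1 P) (gamma2 P) (delta1 P) (delta2 P)).
Local Notation op_graphP := (op_graph a c b q1 q2 (alpha1 P) (alpha2 P)
  (beta1 P) (beta2 P) (beta1' P) (beta2' P) (gamma1 P) (gamma2 P) (delta1 P) (delta2 P)).
Local Notation ipP := (ip a c b (beta1 P) (beta2 P) (beta1' P) (beta2' P)
  (gamma1 P) (gamma2 P) (delta1 P) (delta2 P)).
Local Notation bformP := (bform (beta1 P) (beta2 P)).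
Local Notation bformP' := (bform' (beta1' P) (beta2' P)).
Local Notation char_formP := (char_form (beta1 P) (beta2 P) (beta1' P) (beta2' P)).
Local Notation fundamental_elementP :=
  (fundamental_element a c b (beta1' P) (beta2' P)).
Local Notation re l u := (ext c (complex.Re l) (fun x => complex.Re (u x))).
Local Notation im l u := (ext c (complex.Im l) (fun x => complex.Im (u x))).

Let cq1 := potential_left_continuous.
Let cq2 := potential_right_continuous.

Lemma alpha_gt0 : 0 < alpha1 P ^+ 2 + alpha2 P ^+ 2.
Proof.
rewrite lt_neqAle addr_ge0 ?sqr_ge0// andbT eq_sym paddr_eq0 ?sqr_ge0// !sqrf_eq0.
by have := alpha_neq0 P; rewrite xpair_eqE.
Qed.

Lemma real_scale_eq (g d : R) (z w : R[i]) : g%:C * z = d%:C * w ->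
  g * complex.Re z = d * complex.Re w /\ g * complex.Im z = d * complex.Im w.
Proof.
case: z w => [z1 z2] [w1 w2] /eqP; rewrite eq_complex/= !mul0r !subr0 !addr0.
by move=> /andP[/eqP ? /eqP ?].
Qed.

Lemma complex_tsol lam u du ul ur dul dur : solves P lam u du ->
  ccvg u c^'- ul -> ccvg u c^'+ ur -> ccvg du c^'- dul -> ccvg du c^'+ dur ->
  (gamma1 P)%:C * ul = (delta1 P)%:C * ur ->
  (gamma2 P)%:C * dul = (delta2 P)%:C * dur ->
  tsolP 0 (re ul u) (re dul du) (re ur u) (re dur du)
    (fun x => complex.Re lam * re ul u x - complex.Im lam * im ul u x)
    (fun x => complex.Re lam * re ur u x - complex.Im lam * im ur u x) /\
  tsolP 0 (im ul u) (im dul du) (im ur u) (im dur du)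
    (fun x => complex.Im lam * re ul u x + complex.Re lam * im ul u x)
    (fun x => complex.Im lam * re ur u x + complex.Re lam * im ur u x).
Proof.
move=> [sl sr] cul cur cdl cdr /real_scale_eq[t1 t2] /real_scale_eq[t3 t4].
have [l1 l2] : ode a c (fun x => q1 x - 0) (re ul u) (re dul du)
    (fun x => complex.Re lam * re ul u x - complex.Im lam * im ul u x) /\
   ode a c (fun x => q1 x - 0) (im ul u) (im dul du)
    (fun x => complex.Im lam * re ul u x + complex.Re lam * im ul u x).
  apply: (solves_on_ode ac (D := `[a, c[)) sl.
  - by apply: subset_itv; rewrite bnd_simp.
  - by move=> x; rewrite /= in_itv/= => /andP[_ xc]; rewrite lt_eqF.
  - by left; rewrite /= in_itv/= lexx ac.
  - by right.
  - by move=> x; rewrite in_itv/= => /andP[_ xc]; rewrite /q1 ext_neq// lt_eqF.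
have [r1 r2] : ode c b (fun x => q2 x - 0) (re ur u) (re dur du)
    (fun x => complex.Re lam * re ur u x - complex.Im lam * im ur u x) /\
   ode c b (fun x => q2 x - 0) (im ur u) (im dur du)
    (fun x => complex.Im lam * re ur u x + complex.Re lam * im ur u x).
  apply: (solves_on_ode cb (D := `]c, b])) sr.
  - by apply: subset_itv; rewrite bnd_simp.
  - by move=> x; rewrite /= in_itv/= => /andP[xc _]; rewrite gt_eqF.
  - by right.
  - by left; rewrite /= in_itv/= lexx cb.
  - by move=> x; rewrite in_itv/= => /andP[xc _]; rewrite /q2 ext_neq// gt_eqF.
by split; split; rewrite ?ext_id.
Qed.

Let a1 : a \in `[a, c]. Proof. by rewrite in_itv/= lexx ltW// ac. Qed.
Let b2 : b \in `[c, b]. Proof. by rewrite in_itv/= lexx ltW// cb. Qed.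
Let an : a != c. Proof. by rewrite lt_eqF// ac. Qed.
Let bn : b != c. Proof. by rewrite gt_eqF// cb. Qed.

(** On the pair of real and imaginary parts the real operator acts as multiplication by [lam], seen
    as a real 2 x 2 matrix. *)
Lemma eigen_elements lam u du ul ur dul dur : solves P lam u du ->
  ccvg u c^'- ul -> ccvg u c^'+ ur -> ccvg du c^'- dul -> ccvg du c^'+ dur ->
  (gamma1 P)%:C * ul = (delta1 P)%:C * ur ->
  (gamma2 P)%:C * dul = (delta2 P)%:C * dur ->
  (alpha1 P)%:C * u a + (alpha2 P)%:C * du a = 0 ->
  ((beta1' P)%:C * lam + (beta1 P)%:C) * u b
    - ((beta2' P)%:C * lam + (beta2 P)%:C) * du b = 0 ->
  exists F G : space R,
    [/\ {in `[a, c], re ul u =1 F.1.1}, {in `[c, b], re ur u =1 F.1.2},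
      {in `[a, c], im ul u =1 G.1.1} & {in `[c, b], im ur u =1 G.1.2}] /\
    op_graphP 0 F (complex.Re lam *: F - complex.Im lam *: G) /\
    op_graphP 0 G (complex.Im lam *: F + complex.Re lam *: G).
Proof.
move=> su cul cur cdl cdr t1 t2 ua ub.
have [tr ti] := complex_tsol su cul cur cdl cdr t1 t2.
have [[cu1 _ _ _] [cu2 _ _ _] _ _] := tr; have [[ci1 _ _ _] [ci2 _ _ _] _ _] := ti.
have [F [F1 F2 F3]] := space_extension
  (bformP' (complex.Re (u b)) (complex.Re (du b))) cu1 cu2.
have [G [G1 G2 G3]] := space_extension
  (bformP' (complex.Im (u b)) (complex.Im (du b))) ci1 ci2.
have [ua1 ua2] : alpha1 P * complex.Re (u a) + alpha2 P * complex.Re (du a) = 0 /\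
    alpha1 P * complex.Im (u a) + alpha2 P * complex.Im (du a) = 0.
  move: ua; case: (u a) (du a) => [x y] [z w] /eqP; rewrite eq_complex/= => /andP[/eqP ? /eqP ?].
  by split; lra.
have [ub1 ub2] : - bformP (complex.Re (u b)) (complex.Re (du b)) =
     complex.Re lam * bformP' (complex.Re (u b)) (complex.Re (du b))
     - complex.Im lam * bformP' (complex.Im (u b)) (complex.Im (du b)) /\
   - bformP (complex.Im (u b)) (complex.Im (du b)) =
     complex.Im lam * bformP' (complex.Re (u b)) (complex.Re (du b))
     + complex.Re lam * bformP' (complex.Im (u b)) (complex.Im (du b)).
  move: ub; case: (u b) (du b) => [x y] [z w]; case: (lam) => [l l'] /eqP.
  rewrite eq_complex/= /bform /bform' => /andP[/eqP ? /eqP ?].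
  by split; lra.
exists F, G; split; first by split.
split.
- exists (re dul du), (re dur du); split.
  + apply: (tsol_eq ac cb _ _ _ _ _ _ tr) => x xI; [exact: F1|by []|exact: F2|by []| |].
      by rewrite -[- (_ *: G)]scaleNr space_addZ1 space_scale1 F1// G1// mulNr.
    by rewrite -[- (_ *: G)]scaleNr space_addZ2 space_scale2 F2// G2// mulNr.
  + by rewrite -F1// !ext_neq.
  + by rewrite -F2// !ext_neq.
  + rewrite -F2// !ext_neq// mul0r subr0 ub1 -[- (_ *: G)]scaleNr space_addZ3.
    by rewrite space_scale3 F3 G3 mulNr.
- exists (im dul du), (im dur du); split.
  + apply: (tsol_eq ac cb _ _ _ _ _ _ ti) => x xI; [exact: G1|by []|exact: G2|by []| |].
      by rewrite space_lin1 space_scale1 F1// G1.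
    by rewrite space_lin2 space_scale2 F2// G2.
  + by rewrite -G1// !ext_neq.
  + by rewrite -G2// !ext_neq.
  + rewrite -G2// !ext_neq// mul0r subr0 ub2 space_lin3.
    by rewrite space_scale3 F3 G3.
Qed.

Let alpha0 := alpha_gt0.
Let gamma0 := gamma12_gt0 P.
Let delta0 := delta12_gt0 P.
Let rho0 := rho_gt0 P.

Let ipPC := @ipC R a c b (beta1 P) (beta2 P) (beta1' P) (beta2' P)
  (gamma1 P) (gamma2 P) (delta1 P) (delta2 P).
Let ipPDZl := @ipDZl R a c b (beta1 P) (beta2 P) (beta1' P) (beta2' P)
  (gamma1 P) (gamma2 P) (delta1 P) (delta2 P).

Lemma eigenvalue_real (lam : R[i]) : Defs.eigenvalue P lam -> complex.Im lam = 0 /\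
  exists2 F, op_graphP (complex.Re lam) F 0 & ipP F F != 0.
Proof.
move=> [u [du [su [ul [ur [dul [dur [[cul cur cdl cdr] [t1 t2]]]]]] ua ub [x xI ux]]]].
have [F [G [[F1 F2 G1 G2] [gF gG]]]] := eigen_elements su cul cur cdl cdr t1 t2 ua ub.
have [cF _] := op_graph_continuous gF; have [cG _] := op_graph_continuous gG.
have pos : ipP F F != 0 \/ ipP G G != 0.
  have [F0|] := eqVneq (ipP F F) 0; last by left.
  have [G0|] := eqVneq (ipP G G) 0; last by right.
  have [Fl Fr] := ip_eq0_pieces ac cb gamma0 delta0 rho0 cF F0.
  have [Gl Gr] := ip_eq0_pieces ac cb gamma0 delta0 rho0 cG G0.
  case/negP: ux; rewrite eq_complex/=; case: xI => /=; rewrite in_itv/= => /andP[x1 x2].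
    have xc : x != c by rewrite lt_eqF.
    have xac : x \in `[a, c] by rewrite in_itv/= x1 ltW.
    have := F1 x xac; have := G1 x xac.
    by rewrite Fl// Gl// !ext_neq// => -> ->; rewrite eqxx.
  have xc : x != c by rewrite gt_eqF.
  have xcb : x \in `[c, b] by rewrite in_itv/= x2 ltW.
  have := F2 x xcb; have := G2 x xcb.
  by rewrite Fr// Gr// !ext_neq// => -> ->; rewrite eqxx.
have ge0 := ip_ge0 a c b gamma0 delta0 rho0 (beta1 := beta1 P) (beta2 := beta2 P).
(* Symmetry applied to the two parts reads [- Im lam |G|^2 = Im lam |F|^2], and one of [F], [G] is
   not null. *)
have im0 : complex.Im lam = 0.
  have := op_graph_sym ac cb alpha0 rho0 gF gG.
  rewrite !(ipE ipPC ipPDZl) => h.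
  have : complex.Im lam * (ipP F F + ipP G G) = 0 by lra.
  move/eqP; rewrite mulf_eq0 => /orP[/eqP//|].
  by rewrite paddr_eq0 ?ge0// => /andP[/eqP F0 /eqP G0]; move: pos; rewrite F0 G0 eqxx => -[].
split => //; move: gF gG; rewrite im0 !scale0r subr0 add0r.
move=> /(op_graph_eigen ac cb) gF /(op_graph_eigen ac cb) gG.
by case: pos => p0; [exists F|exists G].
Qed.

Lemma tsol_homogeneous z u1 v1 u2 v2 :
  tsolP 0 u1 v1 u2 v2 (fun x => z * u1 x) (fun x => z * u2 x) ->
  tsolP z u1 v1 u2 v2 (fun=> 0) (fun=> 0).
Proof.
move=> t; rewrite -[z]add0r; apply: (tsol_shift ac cb).
by apply: (tsol_eq ac cb _ _ _ _ _ _ t) => x _ //; rewrite add0r.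
Qed.

(** Uniqueness: with zero data the bound of [tsol_bound] is 0. *)
Lemma tsol_eq0 z u1 v1 u2 v2 : tsolP z u1 v1 u2 v2 (fun=> 0) (fun=> 0) ->
  u1 a = 0 -> v1 a = 0 -> {in `[a, c], forall x, u1 x = 0} /\
  {in `[c, b], forall x, u2 x = 0 /\ v2 x = 0}.
Proof.
move=> t ua va; have [C C0 HC] := tsol_bound ac cb cq1 cq2 (gamma1 P) (gamma2 P) delta0 z.
have [] := HC _ _ _ _ _ _ t; rewrite ua va expr0n/= !add0r.
under eq_Rintegral do rewrite mulr0.
under [X in _ + X]eq_Rintegral do rewrite mulr0.
rewrite !Rintegral_cst// !mul0r addr0 mulr0 => h1 h2.
have sq0 (x y : R) : x ^+ 2 + y ^+ 2 <= 0 -> x = 0 /\ y = 0.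
  move=> h; have := sqr_ge0 x; have := sqr_ge0 y.
  by split; apply/eqP; rewrite -sqrf_eq0; apply/eqP; lra.
by split => [x /h1 /sq0[]|x /h2 /sq0[]].
Qed.

(** The initial values are real, so the imaginary part solves the homogeneous problem with zero
    initial values and vanishes. *)
Lemma fundamental_solution_real z phi dphi : fundamental_solution P z%:C phi dphi ->
  exists l dl ur dur, [/\ fundamentalP z (re l phi) (re dl dphi) (re ur phi) (re dur dphi),
    [/\ ccvg phi c^'- l, ccvg phi c^'+ ur, ccvg dphi c^'- dl & ccvg dphi c^'+ dur],
    (gamma1 P)%:C * l = (delta1 P)%:C * ur /\ (gamma2 P)%:C * dl = (delta2 P)%:C * dur &
    (forall x, (`[a, c[ `|` `]c, b])%classic x -> complex.Im (phi x) = 0) /\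
    complex.Im (dphi b) = 0].
Proof.
move=> [sphi pa dpa [l cl cr] [dl cdl cdr]].
have t1 : (gamma1 P)%:C * l = (delta1 P)%:C * ((gamma1 P / delta1 P)%:C * l).
  by rewrite mulrA -rmorphM/= mulrCA divff ?mulr1// delta1_neq0.
have t2 : (gamma2 P)%:C * dl = (delta2 P)%:C * ((gamma2 P / delta2 P)%:C * dl).
  by rewrite mulrA -rmorphM/= mulrCA divff ?mulr1// delta2_neq0.
have [tr ti] := complex_tsol sphi cl cr cdl cdr t1 t2.
exists l, dl; do 2 eexists; split; [|split; [exact: cl|exact: cr|exact: cdl|exact: cdr]| |].
- split.
  + apply: tsol_homogeneous; apply: (tsol_eq ac cb _ _ _ _ _ _ tr) => x _ //.
      by rewrite /= mul0r subr0.
    by rewrite /= mul0r subr0.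
  + by rewrite ext_neq// pa.
  + by rewrite ext_neq// dpa.
- by [].
have {}ti : tsolP z (im l phi) (im dl dphi) (im ((gamma1 P / delta1 P)%:C * l) phi)
    (im ((gamma2 P / delta2 P)%:C * dl) dphi) (fun=> 0) (fun=> 0).
  apply: tsol_homogeneous; apply: (tsol_eq ac cb _ _ _ _ _ _ ti) => x _ //.
    by rewrite /= mul0r add0r.
  by rewrite /= mul0r add0r.
have [] := tsol_eq0 ti; first by rewrite ext_neq// pa.
  by rewrite ext_neq// dpa/= oppr0.
move=> i1 i2; split; last by have [_] := i2 _ b2; rewrite ext_neq.
move=> x [] /=; rewrite in_itv/= => /andP[x1 x2].
  have := i1 x; rewrite ext_neq ?lt_eqF// => -> //.
  by rewrite in_itv/= x1 ltW.
have := i2 x; rewrite ext_neq ?gt_eqF// => -[] //.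
by rewrite in_itv/= x2 ltW.
Qed.

Lemma op_graph_eigenvalue z phi dphi F : fundamental_solution P z%:C phi dphi ->
  op_graphP z F 0 -> ipP F F != 0 -> Defs.eigenvalue P z%:C.
Proof.
move=> fs gF F0; have [sphi pa dpa _ _] := fs.
have [l [dl [ur [dur [fu [cl cr cdl cdr] [t1 t2] [im0 dim0]]]]]] := fundamental_solution_real fs.
have cf := op_graph_char ac cb cq1 cq2 alpha0 gamma0 delta0 rho0 fu gF F0.
have imb : complex.Im (phi b) = 0.
  by apply: im0; right; rewrite /= in_itv/= lexx cb.
exists phi, dphi; split => //.
- by exists l, ur, dl, dur.
- by rewrite pa dpa mulrN mulrC subrr.
- move: cf; rewrite !ext_neq// /char_form /bform /bform'.
  move: imb dim0; case: (phi b) (dphi b) => [x y] [w v] /= -> -> h.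
  by apply/eqP; rewrite eq_complex/=; apply/andP; split; apply/eqP; lra.
(* If [phi] vanished on both pieces, so would its initial values [alpha2] and [- alpha1]. *)
apply: contrapT => /forall2NP nz.
have [[s1 s2 _ _] ea eda] := fu.
have [cu1 _ _ _] := s1.
have z1 : {in `[a, c], forall x, re l phi x = 0}.
  apply: (within_continuous_eq0 ac cu1) => x; rewrite in_itv/= => /andP[x1 x2].
  rewrite ext_neq ?lt_eqF//; have [] := nz x.
    by case; left; rewrite /= in_itv/= ltW.
  by move/negP; rewrite negbK => /eqP ->.
have := ode_eq0 ac s1 z1 a1; have := z1 _ a1; rewrite ea eda => e2 /eqP.
rewrite oppr_eq0 => /eqP e1; have := alpha0.
by rewrite e1 e2 expr0n/= addr0 ltxx.
Qed.

(* The value of [phi] at the interface [c] is arbitrary. *)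
Definition represents (phi dphi : R -> R[i]) (F : space R) : Prop :=
  [/\ forall x, `[a, c[%classic x -> phi x = (F.1.1 x)%:C,
      forall x, `]c, b]%classic x -> phi x = (F.1.2 x)%:C &
      beta_form' P phi dphi = (F.2)%:C].

Lemma eigenelement_represented z phi dphi : fundamental_solution P z%:C phi dphi ->
  Defs.eigenvalue P z%:C ->
  exists F, [/\ op_graphP z F 0, ipP F F != 0 & represents phi dphi F].
Proof.
move=> fs /eigenvalue_real[_ [G gG G0]].
have [l [dl [ur [dur [fu _ _ [im0 dim0]]]]]] := fundamental_solution_real fs.
have cf := op_graph_char ac cb cq1 cq2 alpha0 gamma0 delta0 rho0 fu gG G0.
have [F fF] := fundamental_element_exists (beta1' P) (beta2' P) fu.
have [F1 F2 F3] := fF; exists F; split.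
- exact: (fundamental_op_graph ac cb fu cf F1 F2 F3).
- exact: (fundamental_not_null ac cb alpha0 gamma0 delta0 rho0 fu fF).
split.
- move=> x xI; rewrite (eq_real_complex (im0 x (or_introl xI))); congr (_%:C).
  move: xI; rewrite /= in_itv/= => /andP[x1 x2].
  by rewrite -F1 ?ext_neq ?lt_eqF// in_itv/= x1 ltW.
- move=> x xI; rewrite (eq_real_complex (im0 x (or_intror xI))); congr (_%:C).
  move: xI; rewrite /= in_itv/= => /andP[x1 x2].
  by rewrite -F2 ?ext_neq ?gt_eqF// in_itv/= x2 ltW.
rewrite F3 /beta_form' /bform' !ext_neq//.
rewrite (eq_real_complex dim0) [phi b]eq_real_complex; last first.
  by apply: im0; right; rewrite /= in_itv/= lexx cb.
by rewrite -!rmorphM -rmorphB.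
Qed.

Lemma norm1_represented phi dphi F : represents phi dphi F ->
  norm1 P (eigenelement P phi dphi) = Num.sqrt (ipP F F).
Proof.
move=> [F1 F2 F3]; rewrite /norm1 /inner1 /eigenelement /=.
have conjr (r : R) : conjc r%:C = r%:C by rewrite /= oppr0.
rewrite (cintegral_left (L2_integrable F.1.1 F.1.1 a c)); last first.
  by move=> t /F1 ->; rewrite conjr -rmorphM.
rewrite (cintegral_right (L2_integrable F.1.2 F.1.2 c b)); last first.
  by move=> t /F2 ->; rewrite conjr -rmorphM.
rewrite F3 conjr -!rmorphM -!rmorphD/= !gtr0_norm//.
Qed.

End Problem.

(** * Transfer of Parseval's equality to the complex eigenfunctions *)

Theorem theorem5p1 (R : realType) (P : transmission_problem R)
    (phi dphi : R[i] -> R -> R[i])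
    (phi_fundamental : forall z : R[i], fundamental_solution P z (phi z) (dphi z))
    (lambda : nat -> R[i])
    (lambda_enum : enumerates_eigenvalues P lambda)
    (f : R -> R)
    (f_left : square_integrable_on `[left_end P, interface P] f)
    (f_right : square_integrable_on `[interface P, right_end P] f) :
  let a := left_end P in
  let c := interface P in
  let b := right_end P in
  let mu := @lebesgue_measure R in
  let psi (n : nat) : R -> R[i] :=
    normalized_eigenfunction P (phi (lambda n)) (dphi (lambda n)) in
  series (fun n : nat =>
    ComplexField.Normc.normc ((gamma1 P * gamma2 P)%:C * cintegral `[a, c] (fun x => (f x)%:C * psi n x)
         + (delta1 P * delta2 P)%:C * cintegral `[c, b] (fun x => (f x)%:C * psi n x))
      ^+ 2) @ \oo -->
  gamma1 P * gamma2 P * (\int[mu]_(x in `[a, c]) (f x ^+ 2))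
  + delta1 P * delta2 P * (\int[mu]_(x in `[c, b]) (f x ^+ 2)).
Proof.
move=> a c b mu psi.
have [ql qlP] := potential_limit_left P; have [qr qrP] := potential_limit_right P.
have [lam_inj lam_eig] := lambda_enum.
have lam_eigen n : Defs.eigenvalue P (lambda n) by apply/lam_eig; exists n.
pose l n := complex.Re (lambda n).
have lamE n : lambda n = (l n)%:C.
  by apply: eq_real_complex; have [] := eigenvalue_real ql qr (lam_eigen n).
have l_inj : injective l.
  by move=> m n lmn; apply: lam_inj; rewrite !lamE lmn.
have /choice[Phi PhiP] : forall n, exists F : space R,
    [/\ op_graph a c b (ext c ql (potential P)) (ext c qr (potential P))
      (alpha1 P) (alpha2 P) (beta1 P) (beta2 P) (beta1' P) (beta2' P)
      (gamma1 P) (gamma2 P) (delta1 P) (delta2 P) (l n) F 0,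
      ip a c b (beta1 P) (beta2 P) (beta1' P) (beta2' P)
       (gamma1 P) (gamma2 P) (delta1 P) (delta2 P) F F != 0 &
      represents P (phi (lambda n)) (dphi (lambda n)) F].
  move=> n; have := phi_fundamental (lambda n); have := lam_eigen n.
  by rewrite lamE => ev fs; exact: (eigenelement_represented qlP qrP fs ev).
set ipP := ip a c b (beta1 P) (beta2 P) (beta1' P) (beta2' P)
  (gamma1 P) (gamma2 P) (delta1 P) (delta2 P) in PhiP.
pose N n := Num.sqrt (ipP (Phi n) (Phi n)).
pose e n := (N n)^-1 *: Phi n.
have ipPC : forall F G, ipP F G = ipP G F := @ipC R a c b _ _ _ _ _ _ _ _.
have ipPDZl : forall k F G H, ipP (k *: F + G) H = k * ipP F H + ipP G H :=
  @ipDZl R a c b _ _ _ _ _ _ _ _.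
have ip_gt0 n : 0 < ipP (Phi n) (Phi n).
  rewrite lt_neqAle eq_sym; have [_ -> _] := PhiP n.
  by rewrite ip_ge0//; [exact: gamma12_gt0|exact: delta12_gt0|exact: rho_gt0].
have N0 n : N n != 0 by rewrite gt_eqF// sqrtr_gt0.
(* The second component 0 removes the boundary term from [ipP F F] and from every coefficient. *)
pose F : space R := (Lfun_Sub _ f_left, Lfun_Sub _ f_right, 0).
have F1 x : x \in `[a, c] -> F.1.1 x = f x by move=> xI; rewrite /= patchE mem_set.
have F2 x : x \in `[c, b] -> F.1.2 x = f x by move=> xI; rewrite /= patchE mem_set.
have ge n : op_graph a c b (ext c ql (potential P)) (ext c qr (potential P))
      (alpha1 P) (alpha2 P) (beta1 P) (beta2 P) (beta1' P) (beta2' P)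
      (gamma1 P) (gamma2 P) (delta1 P) (delta2 P) (l n) (e n) 0.
  have [gPhi _ _] := PhiP n.
  (* Scaling by [(N n)^-1], as the combination of [Phi n] with itself with coefficient
     [(N n)^-1 - 1]. *)
  have := op_graph_lin (left_end_lt_interface P) (interface_lt_right_end P)
    ((N n)^-1 - 1) gPhi gPhi.
  by rewrite scaler0 addr0 scalerBl scale1r subrK.
have e1 n : ipP (e n) (e n) = 1.
  rewrite (ipZl ipPDZl) (ipZr ipPC ipPDZl) -[ipP _ _]sqr_sqrtr ?ltW//.
  by rewrite -/(N n) expr2 mulKf// mulVf.
have l_all z U : op_graph a c b (ext c ql (potential P)) (ext c qr (potential P))
      (alpha1 P) (alpha2 P) (beta1 P) (beta2 P) (beta1' P) (beta2' P)
      (gamma1 P) (gamma2 P) (delta1 P) (delta2 P) z U 0 -> ipP U U != 0 ->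
      exists n, l n = z.
  move=> gU U0; have /lam_eig[n nz] :=
    op_graph_eigenvalue qlP qrP (phi_fundamental z%:C) gU U0.
  by exists n; rewrite /l nz.
have term n : ComplexField.Normc.normc
    ((gamma1 P * gamma2 P)%:C * cintegral `[a, c] (fun x => (f x)%:C * psi n x)
     + (delta1 P * delta2 P)%:C * cintegral `[c, b] (fun x => (f x)%:C * psi n x)) ^+ 2
    = ipP F (e n) ^+ 2.
  have [_ _ rep] := PhiP n; have [r1 r2 _] := rep.
  have psiE x : psi n x = phi (lambda n) x / (N n)%:C.
    by rewrite /psi /normalized_eigenfunction (norm1_represented rep).
  rewrite (cintegral_left (L2_integrable F.1.1 (e n).1.1 a c)); last first.
    move=> x xI; rewrite psiE r1// space_scale1 F1; last first.
      by move: xI; rewrite /= !in_itv/= => /andP[-> /ltW ->].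
    by rewrite -fmorphV/= -!rmorphM/= [_^-1 * _]mulrC.
  rewrite (cintegral_right (L2_integrable F.1.2 (e n).1.2 c b)); last first.
    move=> x xI; rewrite psiE r2// space_scale2 F2; last first.
      by move: xI; rewrite /= !in_itv/= => /andP[/ltW -> ->].
    by rewrite -fmorphV/= -!rmorphM/= [_^-1 * _]mulrC.
  rewrite -!rmorphM -rmorphD/= expr0n/= addr0 sqr_sqrtr ?sqr_ge0//.
  by rewrite /ipP /ip (_ : F.2 = 0)// mul0r mulr0 addr0.
have limE : gamma1 P * gamma2 P * (\int[mu]_(x in `[a, c]) (f x ^+ 2))
  + delta1 P * delta2 P * (\int[mu]_(x in `[c, b]) (f x ^+ 2)) = ipP F F.
  rewrite /ipP /ip (_ : F.2 = 0)// mul0r mulr0 addr0; congr (_ * _ + _ * _).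
    by apply: eq_Rintegral => x; rewrite inE => xI; rewrite F1.
  by apply: eq_Rintegral => x; rewrite inE => xI; rewrite F2.
rewrite limE; under eq_fun do rewrite term.
exact: (op_graph_parseval (left_end_lt_interface P) (interface_lt_right_end P)
  (potential_left_continuous qlP) (potential_right_continuous qrP)
  (alpha_gt0 P) (gamma12_gt0 P) (delta12_gt0 P) (rho_gt0 P) ge e1 l_inj l_all (F := F) erefl).
Qed.
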